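(* Consider the robust Markov decision process (RMDP) problem $\min_{\pi\in\Pi}\max_{p\in\mathcal P}J_\rho(\pi,p)$ with bounded costs, $s$-rectangular ambiguity set and bounded distribution mismatch coefficient, and the Single-loop Robust Policy Gradient method (SRPG), with the parameters $r_1,r_2,\tau,\sigma,\mu$ fixed and satisfying the parameter conditions listed in the context. Suppose that, when SRPG is run for $K$ iterations, $\beta=\beta_K$ satisfies the parameter conditions and is of order $K^{-1/2}$, i.e. $c_1K^{-1/2}\le \beta_K\le c_2K^{-1/2}$ for constants $0<c_1\le c_2$ independent of $K$. Then there is a constant $C>0$, independent of $K$, of the initial point and of $D_\Pi,D_{\mathcal P}$ (it may depend on $S,A,\gamma,\rho$, the mismatch coefficient $D$, $L,\lambda,r_1,r_2,\tau,\sigma,\mu,c_1,c_2$), such that for every integer $K\ge 2$ there exists a positive integer $k<K$ for which $\bar\pi_{k+1}$ is a $C(D_\Pi^{1/2}+D_{\mathcal P}^{1/2})/K^{1/4}$-global optimal solution, i.e. $$\phi(\bar\pi_{k+1})-\min_{\pi\in\Pi}\phi(\pi)\le \frac{C\,(D_\Pi^{1/2}+D_{\mathcal P}^{1/2})}{K^{1/4}},$$ where $\phi(\pi)=\max_{p\in\mathcal P}J_\rho(\pi,p)$, $D_\Pi:=\max_{\pi_1,\pi_2\in\Pi}\|\pi_1-\pi_2\|$ and $D_{\mathcal P}:=\max_{p_1,p_2\in\mathcal P}\|p_1-p_2\|$.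
   Context: **RMDP.** States $\mathcal S=\{1,\dots,S\}$, actions $\mathcal A=\{1,\dots,A\}$, discount factor $\gamma\in(0,1)$, initial distribution $\rho\in\Delta^S$ ($\Delta^d$ is the probability simplex in $\mathbb R^d$), costs $c_{sas'}\in[0,1]$ (bounded cost assumption). A transition kernel is $p=(p_{sa})_{s,a}\in(\Delta^S)^{S\times A}$; policies form $\Pi=(\Delta^A)^S$. The value function is $v_s^{\pi,p}=\mathbb E_{\pi,p}[\sum_{t\ge0}\gamma^t c_{s_ta_ts_{t+1}}\mid s_0=s]$, and $J_\rho(\pi,p)=\sum_s\rho_s v_s^{\pi,p}$. The ambiguity set $\mathcal P\subseteq(\Delta^S)^{S\times A}$ is nonempty, compact, convex and $s$-rectangular: $\mathcal P=\mathcal P_1\times\cdots\times\mathcal P_S$, where $\mathcal P_s$ constrains $(p_{sa})_{a\in\mathcal A}$. $\|\cdot\|$ is the Euclidean/Frobenius norm. **Bounded mismatch.** $d_\rho^{\pi,p}(s')=(1-\gamma)\sum_{s}\sum_{t\ge0}\gamma^t\rho(s)p^\pi_{ss'}(t)$, where $p^\pi_{ss'}(t)$ is the probability of being in $s'$ after $t$ steps from $s$ under $(\pi,p)$. The distribution mismatch coefficient $D=\|d_\rho^{\pi,p}/\rho\|_\infty$ (componentwise ratio) is assumed finite for $p=p^*(\pi)\in\arg\max_{p\in\mathcal P}J_\rho(\pi,p)$ for all $\pi\in\Pi$, and for $\pi=\pi^*(p)\in\arg\min_{\pi\in\Pi}J_\rho(\pi,p)$ for all $p\in\mathcal P$. **Constants.**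 $\ell_\pi:=2\gamma A/(1-\gamma)^3$. $\ell_{\pi p},\ell_{p\pi}>0$ are constants with $\|\nabla_\pi J_\rho(\pi,p)-\nabla_\pi J_\rho(\pi',p')\|\le\ell_{\pi p}(\|\pi-\pi'\|+\|p-p'\|)$ and $\|\nabla_p J_\rho(\pi,p)-\nabla_p J_\rho(\pi',p')\|\le\ell_{p\pi}(\|\pi-\pi'\|+\|p-p'\|)$ for all $\pi,\pi'\in\Pi$, $p,p'\in\mathcal P$. Write $L:=\ell_{\pi p}$ and $\ell_{p\pi}=\lambda L$. **SRPG.** Let $\chi(\pi,p,\bar\pi,\bar p):=J_\rho(\pi,p)+\frac{r_1}{2}\|\pi-\bar\pi\|^2-\frac{r_2}{2}\|p-\bar p\|^2$. Start from $\pi_0=\bar\pi_0\in\Pi$, $p_0=\bar p_0\in\mathcal P$; for $k=0,\dots,K-1$: $\pi_{k+1}=\mathrm{Proj}_\Pi(\pi_k-\tau\nabla_\pi\chi(\pi_k,p_k,\bar\pi_k,\bar p_k))$, $p_{k+1}=\mathrm{Proj}_{\mathcal P}(p_k+\sigma\nabla_p\chi(\pi_{k+1},p_k,\bar\pi_k,\bar p_k))$, $\bar\pi_{k+1}=\bar\pi_k+\beta(\pi_{k+1}-\bar\pi_k)$, $\bar p_{k+1}=\bar p_k+\mu(p_{k+1}-\bar p_k)$, with $\tau,\sigma>0$, $0<\beta,\mu<1$. **Parameter conditions.** $r_1\ge2L$, $r_1>\ell_\pi$, $r_2\ge2\lambda L$, and $0<\tau\le\min\{\frac{4}{3(L+r_1)},\frac1{6\lambda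 L}\}$, $0<\sigma\le\min\{\frac{2}{3\lambda L\kappa_6^2},\frac{1}{6L_{\phi\pi}},\frac{1}{5\lambda\sqrt{\lambda+5}\,L}\}$, $0<\beta\le\min\{\frac{24r_1}{360r_1+5r_1^2\lambda+(2\lambda L+5r_1)^2},\frac{\sigma\lambda^2L^2}{384r_1(\lambda+5)(\lambda+1)^2}\}$, $0<\mu\le\min\{\frac{\lambda+5}{2(\lambda+5)+\lambda^2L^2},\frac{\lambda+5}{\sigma\lambda^2L^2},\frac{\sigma\lambda^2L^2}{64r_2(\lambda+5)}\}$, where $\kappa_6=\frac{2\tau r_1+1}{\tau(r_1-L)}$, $\kappa_1=\frac{\ell_{p\pi}+r_1-\ell_{\pi p}}{r_1-\ell_{\pi p}}$, $L_{\phi\pi}=\ell_{p\pi}\kappa_1+\ell_{p\pi}+r_2$. *)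

(* Defs.v *)
From HB Require Import structures.
From mathcomp Require Import all_boot all_order all_algebra.
From mathcomp Require Import all_classical all_reals all_analysis.

Set Implicit Arguments.
Unset Strict Implicit.
Unset Printing Implicit Defensive.

Import Order.TTheory GRing.Theory Num.Theory.
Import numFieldNormedType.Exports.

Local Open Scope classical_set_scope.
Local Open Scope ring_scope.

(* The library norm `|M| on matrices is the max norm; it induces the same
   topology and derivatives, but the distances below are Frobenius distances. *)
Definition frob (R : realType) m n (M : 'M[R]_(m, n)) : R :=
  Num.sqrt (\sum_i \sum_j M i j ^+ 2).

Definition grad (R : realType) m n (f : 'M[R]_(m, n) -> R) (x : 'M[R]_(m, n)) :
  'M[R]_(m, n) := \matrix_(i, j) 'D_(delta_mx i j) f x.

Definition is_proj (R : realType) m n (X : set 'M[R]_(m, n))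
    (x y : 'M[R]_(m, n)) : Prop :=
  X y /\ forall z, X z -> frob (x - y) <= frob (x - z).

Definition diam (R : realType) m n (X : set 'M[R]_(m, n)) : R :=
  sup [set frob (x - y) | x in X & y in X].

Definition simplex (R : realType) d : set 'rV[R]_d :=
  [set x | (forall i, 0 <= x 0 i) /\ \sum_i x 0 i = 1].

Definition policies (R : realType) nS nA : set 'M[R]_(nS, nA) :=
  [set pi | forall s, simplex (row s pi)].

(* A kernel is stored as a matrix whose row of index (s, a), encoded by
   mxvec_index s a : 'I_(nS * nA), is the next-state distribution p_sa. *)
Definition kslice (R : realType) nS nA (p : 'M[R]_(nS * nA, nS)) (s : 'I_nS) :
  'M[R]_(nA, nS) := \matrix_(a, s') p (mxvec_index s a) s'.

Definition kernels (R : realType) nS nA : set 'M[R]_(nS * nA, nS) :=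
  [set p | forall s a, simplex (row a (kslice p s))].

Definition s_rectangular (R : realType) nS nA (P : set 'M[R]_(nS * nA, nS)) :
  Prop := exists Ps : 'I_nS -> set 'M[R]_(nA, nS),
    P = [set p | forall s, Ps s (kslice p s)].

Definition ambiguity_set (R : realType) nS nA (P : set 'M[R]_(nS * nA, nS)) :
  Prop :=
  [/\ P `<=` @kernels R nS nA, P !=set0, compact P,
      convex_set (P : set (convex_lmodType 'M[R]_(nS * nA, nS)))
    & s_rectangular P].

Definition trans_mx (R : realType) nS nA (pi : 'M[R]_(nS, nA))
    (p : 'M[R]_(nS * nA, nS)) : 'M[R]_nS :=
  \matrix_(s, s') \sum_a pi s a * kslice p s a s'.

(* p^pi_{ss'}(t) *)
Definition step_prob (R : realType) nS nA (pi : 'M[R]_(nS, nA))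
    (p : 'M[R]_(nS * nA, nS)) (t : nat) (s s' : 'I_nS) : R :=
  (trans_mx pi p ^+ t) s s'.

(* E[c_{s_t a_t s_{t+1}} | s_0 = s], where the triple takes the value
   (x, a, y) with probability p^pi_{sx}(t) pi_{xa} p_{xay}. *)
Definition exp_cost (R : realType) nS nA (c : 'I_nS -> 'I_nA -> 'I_nS -> R)
    (pi : 'M[R]_(nS, nA)) (p : 'M[R]_(nS * nA, nS)) (t : nat) (s : 'I_nS) : R :=
  \sum_x \sum_a \sum_y
    step_prob pi p t s x * pi x a * kslice p x a y * c x a y.

(* The costs being bounded, the expectation of the discounted sum is the
   discounted sum of the expectations. The formula makes sense for arbitrary
   matrices, and the series converges near policies and kernels: this is the
   extension of v (and of J below) that the partial derivatives in grad are
   taken of. *)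
Definition value (R : realType) nS nA (gamma : R)
    (c : 'I_nS -> 'I_nA -> 'I_nS -> R)
    (pi : 'M[R]_(nS, nA)) (p : 'M[R]_(nS * nA, nS)) (s : 'I_nS) : R :=
  limn (series (fun t => gamma ^+ t * exp_cost c pi p t s)).

Definition J (R : realType) nS nA (gamma : R) (rho : 'rV[R]_nS)
    (c : 'I_nS -> 'I_nA -> 'I_nS -> R)
    (pi : 'M[R]_(nS, nA)) (p : 'M[R]_(nS * nA, nS)) : R :=
  \sum_s rho 0 s * value gamma c pi p s.

Definition phi (R : realType) nS nA (gamma : R) (rho : 'rV[R]_nS)
    (c : 'I_nS -> 'I_nA -> 'I_nS -> R) (P : set 'M[R]_(nS * nA, nS))
    (pi : 'M[R]_(nS, nA)) : R :=
  sup [set J gamma rho c pi p | p in P].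

Definition occupancy (R : realType) nS nA (gamma : R) (rho : 'rV[R]_nS)
    (pi : 'M[R]_(nS, nA)) (p : 'M[R]_(nS * nA, nS)) (s' : 'I_nS) : R :=
  (1 - gamma) *
  \sum_s limn (series (fun t => gamma ^+ t * rho 0 s * step_prob pi p t s s')).

(* The division is that of \bar R: d / 0 = +oo for d > 0, and 0 / 0 = 0. *)
Definition mismatch (R : realType) nS nA (gamma : R) (rho : 'rV[R]_nS)
    (pi : 'M[R]_(nS, nA)) (p : 'M[R]_(nS * nA, nS)) : \bar R :=
  \big[maxe/0%E]_(s < nS)
    `| (occupancy gamma rho pi p s)%:E / (rho 0 s)%:E |%E.

(* D bounds the mismatch at some worst-case kernel p^*(pi) for every policy pi
   and at some best policy pi^*(p) for every kernel p. *)
Definition bounded_mismatch (R : realType) nS nA (gamma : R) (rho : 'rV[R]_nS)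
    (c : 'I_nS -> 'I_nA -> 'I_nS -> R) (P : set 'M[R]_(nS * nA, nS)) (D : R) :
  Prop :=
  (forall pi, policies pi -> exists p,
     [/\ P p, forall q, P q -> J gamma rho c pi q <= J gamma rho c pi p
       & (mismatch gamma rho pi p <= D%:E)%E]) /\
  (forall p, P p -> exists pi : 'M[R]_(nS, nA),
     [/\ policies pi,
         forall w, policies w -> J gamma rho c pi p <= J gamma rho c w p
       & (mismatch gamma rho pi p <= D%:E)%E]).

Definition l_pi (R : realType) (nA : nat) (gamma : R) : R :=
  2 * gamma * nA%:R / (1 - gamma) ^+ 3.

(* lpip and lppi stand for \ell_{\pi p} and \ell_{p \pi}. *)
Definition grad_lipschitz (R : realType) nS nA (gamma : R) (rho : 'rV[R]_nS)
    (c : 'I_nS -> 'I_nA -> 'I_nS -> R) (P : set 'M[R]_(nS * nA, nS))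
    (lpip lppi : R) : Prop :=
  forall (pi pi' : 'M[R]_(nS, nA)) (p p' : 'M[R]_(nS * nA, nS)),
    policies pi -> policies pi' -> P p -> P p' ->
    frob (grad (fun w => J gamma rho c w p) pi
          - grad (fun w => J gamma rho c w p') pi')
      <= lpip * (frob (pi - pi') + frob (p - p')) /\
    frob (grad (fun q => J gamma rho c pi q) p
          - grad (fun q => J gamma rho c pi' q) p')
      <= lppi * (frob (pi - pi') + frob (p - p')).

Definition kappa1 (R : realType) (lpip lppi r1 : R) : R :=
  (lppi + r1 - lpip) / (r1 - lpip).

Definition kappa6 (R : realType) (L r1 tau : R) : R :=
  (2 * tau * r1 + 1) / (tau * (r1 - L)).

Definition Lphipi (R : realType) (lpip lppi r1 r2 : R) : R :=
  lppi * kappa1 lpip lppi r1 + lppi + r2.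

Definition tau_cond (R : realType) (L lambda r1 tau : R) : Prop :=
  0 < tau <= Num.min (4 / (3 * (L + r1))) (1 / (6 * lambda * L)).

Definition sigma_cond (R : realType) (L lambda r1 r2 tau sigma : R) : Prop :=
  0 < sigma <=
    Num.min (2 / (3 * lambda * L * kappa6 L r1 tau ^+ 2))
   (Num.min (1 / (6 * Lphipi L (lambda * L) r1 r2))
            (1 / (5 * lambda * Num.sqrt (lambda + 5) * L))).

Definition beta_cond (R : realType) (L lambda r1 sigma beta : R) : Prop :=
  0 < beta <=
    Num.min
      (24 * r1 / (360 * r1 + 5 * r1 ^+ 2 * lambda
                  + (2 * lambda * L + 5 * r1) ^+ 2))
      (sigma * lambda ^+ 2 * L ^+ 2
         / (384 * r1 * (lambda + 5) * (lambda + 1) ^+ 2)).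

Definition mu_cond (R : realType) (L lambda r2 sigma mu : R) : Prop :=
  0 < mu <=
    Num.min ((lambda + 5) / (2 * (lambda + 5) + lambda ^+ 2 * L ^+ 2))
   (Num.min ((lambda + 5) / (sigma * lambda ^+ 2 * L ^+ 2))
            (sigma * lambda ^+ 2 * L ^+ 2 / (64 * r2 * (lambda + 5)))).

Definition chi (R : realType) nS nA (gamma : R) (rho : 'rV[R]_nS)
    (c : 'I_nS -> 'I_nA -> 'I_nS -> R) (r1 r2 : R)
    (pi : 'M[R]_(nS, nA)) (p : 'M[R]_(nS * nA, nS))
    (pib : 'M[R]_(nS, nA)) (pb : 'M[R]_(nS * nA, nS)) : R :=
  J gamma rho c pi p + r1 / 2 * frob (pi - pib) ^+ 2
  - r2 / 2 * frob (p - pb) ^+ 2.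

Definition srpg_run (R : realType) nS nA (gamma : R) (rho : 'rV[R]_nS)
    (c : 'I_nS -> 'I_nA -> 'I_nS -> R) (P : set 'M[R]_(nS * nA, nS))
    (r1 r2 tau sigma beta mu : R) (K : nat)
    (pi : nat -> 'M[R]_(nS, nA)) (p : nat -> 'M[R]_(nS * nA, nS))
    (pib : nat -> 'M[R]_(nS, nA)) (pb : nat -> 'M[R]_(nS * nA, nS)) : Prop :=
  [/\ policies (pi 0%N), P (p 0%N), pib 0%N = pi 0%N, pb 0%N = p 0%N
    & forall k, (k < K)%N ->
      [/\ is_proj (@policies R nS nA)
            (pi k - tau *: grad (fun w =>
                             chi gamma rho c r1 r2 w (p k) (pib k) (pb k)) (pi k))
            (pi k.+1),
          is_proj P
            (p k + sigma *: grad (fun q =>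
                        chi gamma rho c r1 r2 (pi k.+1) q (pib k) (pb k)) (p k))
            (p k.+1),
          pib k.+1 = pib k + beta *: (pi k.+1 - pib k)
        & pb k.+1 = pb k + mu *: (p k.+1 - pb k)]].

(* Main.v *)
Require Import Defs.
From mathcomp Require Import all_boot all_order all_algebra.
From mathcomp Require Import all_classical all_reals all_analysis.
From mathcomp Require Import ring lra.

Import Order.TTheory GRing.Theory Num.Theory.
Import numFieldNormedType.Exports.

Local Open Scope classical_set_scope.
Local Open Scope convex_scope.
Local Open Scope ring_scope.

(* Write F(x, y, z) = J(x, y) + r1/2 |x - z|^2, G(y, z) = min_x F(x, y, z),
   M(z) = min_x [phi(x) + r1/2 |x - z|^2] (all minima over policies), and use
     Phi = F(x, y, z) - 2 G(y, z) + 2 M(z) + r2/2 |y - v|^2 >= 0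
   as Lyapunov function along x = pi_k, y = p_k, z = \bar pi_k, v = \bar p_k.
   With u = |x_{k+1} - z_k|, e = |prox(z_k) - argmin F(., y_{k+1}, z_k)| and res
   the sum of the three other residuals, one step decreases Phi by at least
   c res^2 + r1 beta (u^2 / 5 - 2 e^2).  Strong convexity and the gradient
   dominance of J(x, .), which holds because the ambiguity set is s-rectangular
   and the mismatch is bounded, give e^2 <= C res, so that beta e^2 costs only
   O(beta^2) more, and sum_k (res^2 + beta u^2) <= C (1 + K beta^2) = O(1).
   Some k thus has res, u = O(K^(-1/4)).  Gradient dominance in p and then in
   pi at (x_{k+1}, y_{k+1}) bounds the optimality gap by C (res + u); neither a
   minimax theorem nor the subdifferential of phi is needed.  Since D_Pi >= 1 as
   soon as there are two actions, the diameters in the bound are harmless. *)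

(** * Frobenius geometry and strong convexity *)

(** The exponent 1/4 comes from the quality of the estimate of e. Strong convexity controls a
    squared distance by a gap, but J is not concave in p, and gradient dominance bounds that gap
    only by a first-order residual: e^2 is linear, not quadratic, in res. Hence the term beta e^2
    cannot be absorbed by res^2 alone; Young's inequality trades it for beta^2, whose sum over K
    steps stays bounded because beta = O(K^(-1/2)), and the bounded sum of beta u^2 then leaves u^2
    = O(K^(-1/2)) for some step. The order of quantifiers shapes the constants. C is fixed before
    the costs, the ambiguity set and the run, so every constant comes from a bound valid for all of
    them: entrywise bounds on policies and kernels for the diameters, the cost bound for the initial
    value of Phi. Partial derivatives leave the simplices, so the theory of discounted sums is
    developed for matrices with small absolute row sums, of which stochastic ones are a special
    case. *)

Definition dotm {R : realType} {m n} (A B : 'M[R]_(m, n)) : R :=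
  \sum_i \sum_j A i j * B i j.

Section Frobenius.
Context {R : realType} {m n : nat}.
Implicit Types (A B C x y z : 'M[R]_(m, n)) (X : set 'M[R]_(m, n)) (a b t : R).

Lemma dotmC A B : dotm A B = dotm B A.
Proof. by apply: eq_bigr => i _; apply: eq_bigr => j _; rewrite mulrC. Qed.

Lemma dotmDl A B C : dotm (A + B) C = dotm A C + dotm B C.
Proof.
rewrite /dotm -big_split; apply: eq_bigr => i _ /=.
by rewrite -big_split; apply: eq_bigr => j _; rewrite mxE mulrDl.
Qed.

Lemma dotmZl a A B : dotm (a *: A) B = a * dotm A B.
Proof.
rewrite /dotm mulr_sumr; apply: eq_bigr => i _.
by rewrite mulr_sumr; apply: eq_bigr => j _; rewrite mxE mulrA.
Qed.

Lemma dotmNl A B : dotm (- A) B = - dotm A B.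
Proof. by rewrite -scaleN1r dotmZl mulN1r. Qed.

Lemma dotmDr A B C : dotm C (A + B) = dotm C A + dotm C B.
Proof. by rewrite !(dotmC C) dotmDl. Qed.

Lemma dotmZr a A B : dotm B (a *: A) = a * dotm B A.
Proof. by rewrite !(dotmC B) dotmZl. Qed.

Lemma dotmNr A B : dotm B (- A) = - dotm B A.
Proof. by rewrite !(dotmC B) dotmNl. Qed.

Definition dotmE := (dotmDl, dotmDr, dotmNl, dotmNr, dotmZl, dotmZr).

Lemma dotm_ge0 A : 0 <= dotm A A.
Proof. by do 2!(apply: sumr_ge0 => ? _); rewrite -expr2 sqr_ge0. Qed.

Lemma frob_sq A : frob A ^+ 2 = dotm A A.
Proof.
rewrite /frob sqr_sqrtr; last by do 2!(apply: sumr_ge0 => ? _); rewrite sqr_ge0.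
by apply: eq_bigr => i _; apply: eq_bigr => j _; rewrite expr2.
Qed.

Lemma frob_ge0 A : 0 <= frob A. Proof. exact: sqrtr_ge0. Qed.

Lemma frobN A : frob (- A) = frob A.
Proof. by apply/eqP; rewrite -(eqrXn2 (n := 2))// ?frob_ge0// !frob_sq !dotmE opprK. Qed.

Lemma frobBC A B : frob (A - B) = frob (B - A).
Proof. by rewrite -frobN opprB. Qed.

Lemma frob0 : frob (0 : 'M[R]_(m, n)) = 0.
Proof.
apply/eqP; rewrite -sqrf_eq0 frob_sq -(scale0r (0 : 'M[R]_(m, n))) dotmZl.
by rewrite mul0r.
Qed.

Lemma frobZ a A : 0 <= a -> frob (a *: A) = a * frob A.
Proof.
move=> a0; apply/eqP; rewrite -(eqrXn2 (n := 2))// ?frob_ge0//.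
  by rewrite exprMn !frob_sq !dotmE mulrA.
by rewrite mulr_ge0 ?frob_ge0.
Qed.

Lemma dotm_le A B : dotm A B <= frob A * frob B.
Proof.
have [B0|B0] := eqVneq (dotm B B) 0.
  suff : dotm A B = 0 by move=> ->; rewrite mulr_ge0 ?frob_ge0.
  apply/eqP; rewrite eq_le !leNgt; apply/andP; split; apply/negP => h.
    (* With B.B = 0 the square of A - t B is A.A - 2 t A.B. This t makes it A.A - 2 (1 + A.A) < 0,
       which contradicts A.B <> 0. *)
    have := dotm_ge0 (A - (1 + dotm A A) / (dotm A B) *: B).
    rewrite !dotmE B0 (dotmC B A); have := dotm_ge0 A.
    have : (1 + dotm A A) / dotm A B * dotm A B = 1 + dotm A A.
      by rewrite divfK// gt_eqF.
    by nra.
  have := dotm_ge0 (A - (1 + dotm A A) / (dotm A B) *: B).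
  rewrite !dotmE B0 (dotmC B A); have := dotm_ge0 A.
  have : (1 + dotm A A) / dotm A B * dotm A B = 1 + dotm A A.
    by rewrite divfK// lt_eqF.
  by nra.
have Bp : 0 < dotm B B by rewrite lt_def B0 dotm_ge0.
rewrite (le_trans (ler_norm _))// -ler_sqr ?nnegrE ?mulr_ge0 ?frob_ge0//.
rewrite real_normK ?num_real// exprMn !frob_sq.
have := dotm_ge0 (dotm B B *: A - dotm A B *: B).
rewrite !dotmE (dotmC B A).
rewrite [X in 0 <= X](_ : _ = dotm B B * (dotm A A * dotm B B - dotm A B ^+ 2));
  last by ring.
by rewrite pmulr_rge0// subr_ge0.
Qed.

Lemma dotm_le_of A B a b : frob A <= a -> frob B <= b -> dotm A B <= a * b.
Proof.
move=> ha hb; rewrite (le_trans (dotm_le _ _))// ler_pM ?frob_ge0//.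
Qed.

Lemma frobD A B : frob (A + B) <= frob A + frob B.
Proof.
rewrite -ler_sqr ?nnegrE ?addr_ge0 ?frob_ge0// frob_sq !dotmE (dotmC B A).
by have := dotm_le A B; rewrite sqrrD !frob_sq; lra.
Qed.

Lemma frob_triangle A B C : frob (A - C) <= frob (A - B) + frob (B - C).
Proof. by rewrite (le_trans _ (frobD _ _))// addrA subrK. Qed.

Lemma entry_le_frob A i j : `|A i j| <= frob A.
Proof.
rewrite -ler_sqr ?nnegrE ?frob_ge0// real_normK ?num_real// frob_sq.
rewrite /dotm (bigD1 i)//= (bigD1 j)//= -expr2 -addrA lerDl addr_ge0//.
  by apply: sumr_ge0 => k _; rewrite -expr2 sqr_ge0.
by do 2!(apply: sumr_ge0 => ? _); rewrite -expr2 sqr_ge0.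
Qed.

Lemma frob_le_sum A : frob A <= \sum_i \sum_j `|A i j|.
Proof.
have S0 (i : 'I_m) : 0 <= \sum_j `|A i j| by apply: sumr_ge0.
rewrite -ler_sqr ?nnegrE ?frob_ge0//; last exact: sumr_ge0.
rewrite frob_sq expr2 mulr_suml; apply: ler_sum => i _.
apply: le_trans (_ : (\sum_j `|A i j|) * (\sum_j `|A i j|) <= _); last first.
  by apply: ler_wpM2l => //; rewrite (bigD1 i)//= lerDl sumr_ge0.
rewrite mulr_suml; apply: ler_sum => j _.
rewrite (le_trans (ler_norm _))// normrM; apply: ler_wpM2l => //.
by rewrite (bigD1 j)//= lerDl sumr_ge0.
Qed.

Lemma frob_le_const A a : 0 <= a -> (forall i j, `|A i j| <= a) ->
  frob A <= m%:R * n%:R * a.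
Proof.
move=> a0 h; rewrite (le_trans (frob_le_sum A))//.
rewrite -mulrA mulr_natl -[X in _ *+ X]card_ord -sumr_const.
apply: ler_sum => i _; rewrite mulr_natl -[X in _ *+ X]card_ord -sumr_const.
exact: ler_sum.
Qed.

Definition segment_closed X := forall x y t, X x -> X y -> 0 <= t <= 1 ->
  X (x + t *: (y - x)).

Lemma proj_dotm_le X x y : segment_closed X -> is_proj X x y ->
  forall z, X z -> dotm (x - y) (z - y) <= 0.
Proof.
move=> cX [Xy hy] z Xz; rewrite leNgt; apply/negP => h.
set d := dotm (x - y) (z - y) in h.
set q := dotm (z - y) (z - y).
have q0 : 0 <= q := dotm_ge0 _.
(* Moving by t towards z changes the squared distance by t (t q - 2 d). The denominator d + q gives
   t <= 1 and t q < 2 d at once, also when q = 0. *)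
pose t := d / (d + q).
have dq : 0 < d + q by lra.
have tK : t * (d + q) = d by rewrite /t divfK// gt_eqF.
have t0 : 0 < t by rewrite /t divr_gt0.
have t1 : t <= 1 by rewrite /t ler_pdivrMr// mul1r; lra.
have := hy _ (cX y z t Xy Xz _); rewrite ltW//= => /(_ t1).
rewrite -ler_sqr ?nnegrE ?frob_ge0// !frob_sq leNgt => /negP; apply.
have -> : x - (y + t *: (z - y)) = (x - y) - t *: (z - y) by rewrite opprD addrA.
rewrite [ltLHS](_ : _ = dotm (x - y) (x - y) - 2 * t * d + t ^+ 2 * q).
  have : t * q < 2 * d by nra.
  by nra.
have -> : forall B : 'M[R]_(m, n), dotm ((x - y) - t *: B) ((x - y) - t *: B) =
   dotm (x - y) (x - y) - 2 * t * dotm (x - y) B + t ^+ 2 * dotm B B.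
  by move=> B; move: (x - y) => A; rewrite !dotmE (dotmC B A); ring.
by [].
Qed.

Definition strongly_convex X (f : 'M[R]_(m, n) -> R) (k : R) :=
  forall x y t, X x -> X y -> 0 <= t <= 1 ->
  f (x + t *: (y - x)) <=
    (1 - t) * f x + t * f y - k / 2 * (t * (1 - t)) * frob (y - x) ^+ 2.

Definition is_min X (f : 'M[R]_(m, n) -> R) x :=
  X x /\ forall y, X y -> f x <= f y.

Lemma min_quad_growth X f k x y : segment_closed X -> strongly_convex X f k ->
  is_min X f x -> X y -> f x + k / 2 * frob (y - x) ^+ 2 <= f y.
Proof.
move=> cX sf [Xx hx] Xy; rewrite leNgt; apply/negP => h.
set q := frob _ ^+ 2 in h; have q0 : 0 <= q by rewrite sqr_ge0.
have key t : 0 < t <= 1 -> 0 <= (f y - f x) - k / 2 * (1 - t) * q.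
  move=> /andP[t0 t1].
  have t01 : 0 <= t <= 1 by rewrite ltW.
  have := le_trans (hx _ (cX _ _ _ Xx Xy t01)) (sf _ _ _ Xx Xy t01).
  rewrite -/q => h1.
  have : 0 <= t * ((f y - f x) - k / 2 * (1 - t) * q) by nra.
  by rewrite pmulr_rge0.
(* At t = 1 this reads f x <= f y; with the negated goal it forces k q > 0. *)
have h1 := key 1 ltac:(lra).
have kq : 0 < k / 2 * q by lra.
pose g := k / 2 * q - (f y - f x).
have g0 : 0 < g by rewrite /g; lra.
have gk : g <= k / 2 * q by rewrite /g; lra.
(* In place of the limit t -> 0: for this t the error term t k q / 2 is only half of the deficit
   g. *)
pose t := g / (k / 2 * q) / 2.
have tK : t * (k / 2 * q) = g / 2.
  by rewrite /t mulrAC divfK// gt_eqF.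
have t0 : 0 < t by rewrite /t !divr_gt0.
have t1 : t <= 1.
  by rewrite /t ler_pdivrMr// mul1r ler_pdivrMr//; lra.
have := key t ltac:(lra).
have -> : f y - f x - k / 2 * (1 - t) * q = f y - f x - k / 2 * q + t * (k / 2 * q) by ring.
rewrite tK; move: g0; rewrite /g; lra.
Qed.

End Frobenius.

(** * Discounted resolvents *)

(** A bound on the operator norm for the max norm on columns. It allows signed entries, hence also
    the perturbed matrices of a difference quotient. *)
Definition rows_le {R : realType} {n} (b : R) (P : 'M[R]_n) :=
  forall i, \sum_j `|P i j| <= b.

Definition resolvent {R : realType} {n} (gamma : R) (P : 'M[R]_n) : 'M[R]_n :=
  invmx (1%:M - gamma *: P).

Section Resolvent.
Context {R : realType} {n : nat}.
Implicit Types (gamma b B : R) (P : 'M[R]_n) (x y : 'cV[R]_n).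

Lemma rows_le_mul b B P x : rows_le b P -> (forall i, `|x i 0| <= B) ->
  forall i, `|(P *m x) i 0| <= b * B.
Proof.
move=> hP hx i; rewrite mxE (le_trans (ler_norm_sum _ _ _))//.
have B0 : 0 <= B := le_trans (normr_ge0 _) (hx i).
apply: le_trans (_ : \sum_j `|P i j| * B <= _).
  by apply: ler_sum => j _; rewrite normrM ler_wpM2l.
by rewrite -mulr_suml ler_wpM2r.
Qed.

(* Evaluate the fixed-point equation at an entry of y of maximal modulus. *)
Lemma fixpoint_bound gamma b B P x y : 0 <= gamma -> gamma * b < 1 ->
  rows_le b P -> y = x + gamma *: (P *m y) -> (forall i, `|x i 0| <= B) ->
  forall i, `|y i 0| <= B / (1 - gamma * b).
Proof.
move=> g0 gb hP hy hx i.
pose k := [arg max_(k > i) `|y k 0|]%O.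
have hk j : `|y j 0| <= `|y k 0| by rewrite /k; case: arg_maxP => // l _; apply.
apply: le_trans (hk i) _; rewrite ler_pdivlMr ?subr_gt0//.
have e : y k 0 = x k 0 + gamma * (P *m y) k 0 by rewrite {1}hy !mxE.
have h1 := rows_le_mul b _ P y hP hk k.
have : `|y k 0| <= `|x k 0| + gamma * `|(P *m y) k 0|.
  by rewrite {1}e (le_trans (ler_normD _ _))// normrM (ger0_norm g0).
have := hx k; have : gamma * `|(P *m y) k 0| <= gamma * (b * `|y k 0|).
  exact: ler_wpM2l.
by lra.
Qed.

Section Bounded.
Context (gamma b : R) (P : 'M[R]_n).
Hypotheses (g0 : 0 <= gamma) (gb : gamma * b < 1) (hP : rows_le b P).
Let N := resolvent gamma P.

(** A kernel vector solves the fixed-point equation with source 0, so [fixpoint_bound] with B = 0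
    makes it vanish. *)
Lemma resolvent_unit : 1%:M - gamma *: P \in unitmx.
Proof.
rewrite -unitmx_tr -row_free_unit; apply: inj_row_free => v hv.
have h : v^T = 0 + gamma *: (P *m v^T).
  have : (1%:M - gamma *: P) *m v^T = 0.
    by apply: trmx_inj; rewrite trmx_mul trmxK hv trmx0.
  by rewrite add0r mulmxBl mul1mx -scalemxAl => /eqP; rewrite subr_eq0 => /eqP.
apply/rowP => i; have := fixpoint_bound gamma b 0 P 0 v^T g0 gb hP h.
move=> /(_ _ i); rewrite !mxE mul0r normr_le0 => H; apply/eqP/H => j.
by rewrite mxE normr0.
Qed.

Lemma resolventEl : N = 1%:M + gamma *: (P *m N).
Proof.
have := mulmxV resolvent_unit; rewrite -/N mulmxBl mul1mx -scalemxAl => /eqP.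
by rewrite subr_eq addrC => /eqP; rewrite addrC.
Qed.

Lemma resolvent_fixpoint x : N *m x = x + gamma *: (P *m (N *m x)).
Proof. by rewrite {1}resolventEl mulmxDl mul1mx -scalemxAl mulmxA. Qed.

Lemma resolvent_bound B x : (forall i, `|x i 0| <= B) ->
  forall i, `|(N *m x) i 0| <= B / (1 - gamma * b).
Proof. exact: fixpoint_bound (resolvent_fixpoint x). Qed.

Lemma discounted_series x i :
  series (fun t => gamma ^+ t * (P ^+ t *m x) i 0) @ \oo --> (N *m x) i 0.
Proof.
pose y := N *m x.
(* The Neumann series telescopes: its partial sums miss N x by a remainder of size (gamma b)^k. *)
have partial k : series (fun t => gamma ^+ t * (P ^+ t *m x) i 0) k =
    y i 0 - gamma ^+ k * (P ^+ k *m y) i 0.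
  rewrite /series /=; elim: k => [|k IH].
    by rewrite big_geq// !expr0 -idmxE mul1mx mul1r subrr.
  rewrite big_nat_recr//= IH {2}/y resolvent_fixpoint -/y mulmxDr -scalemxAr.
  have e : (P ^+ k *m x + gamma *: (P ^+ k *m (P *m y))) i 0 =
    (P ^+ k *m x) i 0 + gamma * (P ^+ k.+1 *m y) i 0.
    by rewrite mulmxA exprSr -mulmxE !mxE.
  by rewrite e [gamma ^+ k.+1]exprSr; ring.
have yB j : `|y j 0| <= \sum_k `|y k 0| by rewrite (bigD1 j)//= lerDl sumr_ge0.
have powB k j : `|(P ^+ k *m y) j 0| <= b ^+ k * \sum_k `|y k 0|.
  elim: k j => [|k IH] j; first by rewrite !expr0 -idmxE mul1mx mul1r.
  rewrite exprS -mulmxE -mulmxA exprS -mulrA.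
  exact: rows_le_mul.
have b0 : 0 <= b by apply: le_trans (hP i); apply: sumr_ge0.
have -> : series (fun t => gamma ^+ t * (P ^+ t *m x) i 0) =
   (fun k => y i 0 - gamma ^+ k * (P ^+ k *m y) i 0) by apply/funext.
rewrite -[X in _ --> X]subr0; apply: cvgB; first exact: cvg_cst.
pose S := \sum_k `|y k 0|.
have geo : geometric S (gamma * b) @ \oo --> (0 : R).
  by apply: cvg_geometric; rewrite ger0_norm// mulr_ge0.
apply: (@squeeze_cvgr _ _ _ _ (fun k => - geometric S (gamma * b) k)
   (geometric S (gamma * b))) => //; last first.
  by rewrite -[X in _ --> X]oppr0; apply: cvgN.
near=> k; rewrite -ler_norml normrM ger0_norm ?exprn_ge0//= exprMn.
by rewrite mulrCA ler_wpM2l ?exprn_ge0// mulrC; exact: powB.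
Unshelve. all: by end_near. Qed.

End Bounded.

Definition stochastic P := (forall i j, 0 <= P i j) /\ forall i, \sum_j P i j = 1.

Lemma stochastic_rows_le P : stochastic P -> rows_le 1 P.
Proof.
by move=> [P0 P1] i; rewrite -(P1 i) ler_sum// => j _; rewrite ger0_norm.
Qed.

(* Minimum principle: evaluate the fixed-point equation at a minimal entry. *)
Lemma resolvent_ge gamma P x : 0 <= gamma < 1 -> stochastic P ->
  (forall i, 0 <= x i 0) -> forall i, x i 0 <= (resolvent gamma P *m x) i 0.
Proof.
move=> /andP[g0 g1] sP x0 i; have hP := stochastic_rows_le _ sP.
case: sP => P0 P1; set y := _ *m x.
have gb : gamma * 1 < 1 by rewrite mulr1.
have e j : y j 0 = x j 0 + gamma * \sum_l P j l * y l 0.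
  by rewrite /y {1}(resolvent_fixpoint _ _ _ g0 gb hP) !mxE.
pose k := [arg min_(k < i) y k 0]%O.
have hk j : y k 0 <= y j 0 by rewrite /k; case: arg_minP => // l _; apply.
have avg j : y k 0 <= \sum_l P j l * y l 0.
  rewrite -[y k 0]mul1r -(P1 j) mulr_suml.
  by apply: ler_sum => l _; rewrite ler_wpM2l.
have yk : 0 <= y k 0.
  have := e k; have : gamma * y k 0 <= gamma * \sum_l P k l * y l 0.
    exact: ler_wpM2l.
  have := x0 k => h1 h2 h3; have : 0 <= (1 - gamma) * y k 0 by lra.
  by rewrite pmulr_rge0// subr_gt0.
by rewrite e lerDl mulr_ge0//; exact: le_trans yk (avg i).
Qed.

Lemma rows_le_near gamma b P (E : 'M[R]_n) : 0 <= gamma -> gamma * b < 1 ->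
  rows_le b P -> exists2 b', gamma * b' < 1 &
    \forall h \near (0 : R), rows_le b' (P + h *: E).
Proof.
(* This e gives gamma (b + e) = 1 - e < 1; the denominator gamma + 1 stays positive at gamma = 0. *)
move=> g0 gb hP; pose e := (1 - gamma * b) / (gamma + 1).
have e0 : 0 < e by rewrite divr_gt0 ?subr_gt0// ltr_wpDl.
exists (b + e).
  have : e * (gamma + 1) = 1 - gamma * b by rewrite /e divfK// gt_eqF// ltr_wpDl.
  by lra.
pose S := \sum_i \sum_j `|E i j|.
have S0 : 0 <= S by do 2!(apply: sumr_ge0 => ? _).
near=> h => i.
apply: le_trans (_ : \sum_j (`|P i j| + `|h| * `|E i j|) <= _).
  by apply: ler_sum => j _; rewrite !mxE -normrM ler_normD.
rewrite big_split/= lerD// -mulr_sumr.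
apply: le_trans (_ : `|h| * S <= _).
  by rewrite ler_wpM2l// /S [leRHS](bigD1 i)//= lerDl sumr_ge0// => k _; rewrite sumr_ge0.
have : `|h| <= e / (S + 1).
  by near: h; apply: (@nbhs0_le R R^o); rewrite divr_gt0// ltr_wpDl.
rewrite ler_pdivlMr ?ltr_wpDl//; apply: le_trans.
by rewrite ler_wpM2l// lerDl.
Unshelve. all: by end_near. Qed.

(** The second resolvent identity. It yields both the continuity of the resolvent and the
    performance difference formula. *)
Lemma resolvent_identity gamma b b' P P' : 0 <= gamma ->
  gamma * b < 1 -> rows_le b P -> gamma * b' < 1 -> rows_le b' P' ->
  resolvent gamma P' - resolvent gamma P =
    gamma *: (resolvent gamma P' *m (P' - P) *m resolvent gamma P).
Proof.
move=> g0 gb hP gb' hP'.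
have U := resolvent_unit gamma b P g0 gb hP.
have U' := resolvent_unit gamma b' P' g0 gb' hP'.
have -> : gamma *: (resolvent gamma P' *m (P' - P) *m resolvent gamma P) =
  resolvent gamma P' *m ((1%:M - gamma *: P) - (1%:M - gamma *: P')) *m resolvent gamma P.
  have -> : (1%:M - gamma *: P) - (1%:M - gamma *: P') = gamma *: (P' - P).
    by rewrite opprB addrC addrA subrK -scalerBr.
  by rewrite -scalemxAr -scalemxAl.
rewrite mulmxBr mulmxBl -mulmxA (mulmxV U) mulmx1.
by rewrite (mulVmx U') mul1mx.
Qed.

Lemma cvg_of_lipschitz (f : R -> R) (l C : R) :
  (\forall h \near (0 : R), `|f h - l| <= C * `|h|) -> f h @[h --> 0] --> l.
Proof.
move=> hf; apply/cvgrPdist_le => e e0.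
near=> h; rewrite distrC; have /le_trans -> // : `|f h - l| <= C * `|h|.
  by near: h.
have C1 : 0 < `|C| + 1 by rewrite ltr_wpDl.
have : `|h| <= e / (`|C| + 1).
  by near: h; apply: (@nbhs0_le R R^o); rewrite divr_gt0.
rewrite ler_pdivlMr// mulrC; apply: le_trans.
by rewrite ler_wpM2r// (le_trans (ler_norm _))// lerDl.
Unshelve. all: by end_near. Qed.

(** By the resolvent identity the difference is h times a quantity that contains the perturbed
    resolvent, which the common row bound b' keeps bounded near h = 0. *)
Lemma resolvent_cvg gamma b P (E : 'M[R]_n) (u : 'rV[R]_n) x :
  0 <= gamma -> gamma * b < 1 -> rows_le b P ->
  (u *m resolvent gamma (P + h *: E) *m x) 0 0 @[h --> (0 : R)] -->
    (u *m resolvent gamma P *m x) 0 0.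
Proof.
move=> g0 gb hP; have [b' gb' near_b'] := rows_le_near gamma b P E g0 gb hP.
pose z := E *m (resolvent gamma P *m x).
pose B := \sum_i `|z i 0|.
have zB i : `|z i 0| <= B by rewrite /B (bigD1 i)//= lerDl sumr_ge0.
pose C := \sum_i `|u 0 i| * (gamma * (B / (1 - gamma * b'))).
apply: (@cvg_of_lipschitz _ _ C); near=> h.
have hb' : rows_le b' (P + h *: E) by near: h.
have -> : (u *m resolvent gamma (P + h *: E) *m x) 0 0
    - (u *m resolvent gamma P *m x) 0 0 =
  h * \sum_i u 0 i * (gamma * (resolvent gamma (P + h *: E) *m z) i 0).
  have : u *m resolvent gamma (P + h *: E) *m x - u *m resolvent gamma P *m x =
    h *: (u *m (gamma *: (resolvent gamma (P + h *: E) *m z))).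
    rewrite -mulmxBl -mulmxBr.
    rewrite (resolvent_identity gamma b b' _ _ g0 gb hP gb' hb').
    rewrite addrAC subrr add0r.
    do ?[rewrite -scalemxAr | rewrite -scalemxAl].
    by rewrite !scalerA mulrC /z !mulmxA.
  move=> /(congr1 (fun M : 'M[R]_1 => M 0 0)).
  have sub00 (M M' : 'M[R]_1) : (M - M') 0 0 = M 0 0 - M' 0 0 by rewrite !mxE.
  rewrite sub00 => ->; rewrite mxE; congr (_ * _).
  by rewrite mxE; apply: eq_bigr => i _; congr (_ * _); rewrite mxE.
rewrite normrM mulrC ler_wpM2r// (le_trans (ler_norm_sum _ _ _))//.
apply: ler_sum => i _; rewrite !normrM ler_wpM2l// (ger0_norm g0) ler_wpM2l//.
exact: (resolvent_bound gamma b').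
Unshelve. all: by end_near. Qed.

End Resolvent.

(** Suited to exact difference formulas: the increment arrives already factored by h, and only the
    limit of the cofactor k remains to be found. *)
Lemma is_derive_quotient {R : realType} {m n} (F : 'M[R]_(m, n) -> R) (x v : 'M[R]_(m, n))
    (k : R -> R) d :
  (\forall h \near (0 : R), F (x + h *: v) - F x = h * k h) ->
  k h @[h --> (0 : R)] --> d -> is_derive x v F d.
Proof.
move=> hF hk.
have lim_quot : (h^-1 *: ((F \o shift x) (h *: v) - F x)) @[h --> (0 : R)^'] --> d.
  have hk' : k h @[h --> (0 : R)^'] --> d by apply: cvg_within_filter hk.
  apply: cvg_trans hk'; apply: near_eq_cvg; near=> h.
  have h0 : h != 0 by near: h; exact: nbhs_dnbhs_neq.
  have e : F (x + h *: v) - F x = h * k h.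
    by near: h; apply: nbhs_dnbhs; exact: hF.
  by rewrite /= [h *: v + x]addrC e /GRing.scale/= mulKf.
split; first by apply/cvg_ex; exists d.
exact: cvg_lim lim_quot.
Unshelve. all: by end_near. Qed.

(** [grad] records partial derivatives only. Pairing it with an arbitrary direction requires the
    directional derivatives to be linear in the direction. *)
Lemma dotm_grad {R : realType} {m n} (F : 'M[R]_(m, n) -> R) (x : 'M[R]_(m, n))
    (D : 'M[R]_(m, n) -> R) :
  (forall v, is_derive x v F (D v)) ->
  (forall a u v, D (a *: u + v) = a * D u + D v) ->
  forall v, dotm (grad F x) v = D v.
Proof.
move=> dF linD v.
have D0 : D 0 = 0.
  by have := linD 1 0 0; rewrite scaler0 addr0 mul1r; lra.
have DD u w : D (u + w) = D u + D w by rewrite -[u]scale1r linD mul1r scale1r.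
have DZ a u : D (a *: u) = a * D u by rewrite -[a *: u]addr0 linD D0 addr0.
rewrite [in RHS](matrix_sum_delta v) (big_morph D DD D0).
apply: eq_bigr => i _; rewrite (big_morph D DD D0); apply: eq_bigr => j _.
by rewrite DZ mxE mulrC; have -> := derive_val (is_derive := dF (delta_mx i j)).
Qed.

(** * Performance difference and derivatives of the value *)

Section MDP.
Context {R : realType} {nS nA : nat} (gamma : R) (rho : 'rV[R]_nS)
  (c : 'I_nS -> 'I_nA -> 'I_nS -> R).
Local Notation policy := 'M[R]_(nS, nA).
Local Notation kernel := 'M[R]_(nS * nA, nS).
Implicit Types (pi v : policy) (p q : kernel) (h : R).

Definition step_cost pi p : 'cV[R]_nS :=
  \col_s \sum_a \sum_y pi s a * kslice p s a y * c s a y.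

(** Expected discounted numbers of visits from rho: the occupancy measure without its factor 1 -
    gamma. *)
Definition visits pi p : 'rV[R]_nS := rho *m resolvent gamma (trans_mx pi p).

Definition Vvec pi p : 'cV[R]_nS :=
  resolvent gamma (trans_mx pi p) *m step_cost pi p.

Definition cost_to_go pi p s a y := c s a y + gamma * Vvec pi p y 0.

Definition Qval pi p s a := \sum_y kslice p s a y * cost_to_go pi p s a y.

Lemma kslice_addZ p q h s a y :
  kslice (p + h *: q) s a y = kslice p s a y + h * kslice q s a y.
Proof. by rewrite !mxE. Qed.

Lemma trans_mx_addl pi v h p :
  trans_mx (pi + h *: v) p = trans_mx pi p + h *: trans_mx v p.
Proof.
apply/matrixP => s y; rewrite !mxE mulr_sumr -big_split/=; apply: eq_bigr => a _.
by rewrite !mxE mulrDl mulrA.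
Qed.

Lemma trans_mx_addr pi p q h :
  trans_mx pi (p + h *: q) = trans_mx pi p + h *: trans_mx pi q.
Proof.
apply/matrixP => s y; rewrite !mxE mulr_sumr -big_split/=; apply: eq_bigr => a _.
by rewrite kslice_addZ mulrDr; congr (_ + _); rewrite mulrCA.
Qed.

Lemma exp_costE pi p t s :
  exp_cost c pi p t s = (trans_mx pi p ^+ t *m step_cost pi p) s 0.
Proof.
rewrite /exp_cost mxE; apply: eq_bigr => x _; rewrite mxE mulr_sumr.
apply: eq_bigr => a _; rewrite mulr_sumr; apply: eq_bigr => y _.
by rewrite /step_prob !mulrA.
Qed.

Section Contractive.
Context (b : R) (pi : policy) (p : kernel).
Hypotheses (g0 : 0 <= gamma) (gb : gamma * b < 1) (hb : rows_le b (trans_mx pi p)).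

Lemma valueE s : value gamma c pi p s = Vvec pi p s 0.
Proof.
rewrite /value; have -> : (fun t => gamma ^+ t * exp_cost c pi p t s) =
  (fun t => gamma ^+ t * (trans_mx pi p ^+ t *m step_cost pi p) s 0).
  by apply/funext => t; rewrite exp_costE.
apply: cvg_lim => //; exact: (discounted_series gamma b).
Qed.

Lemma JE : J gamma rho c pi p = (rho *m Vvec pi p) 0 0.
Proof. by rewrite mxE; apply: eq_bigr => s _; rewrite valueE. Qed.

Lemma occupancyE s : occupancy gamma rho pi p s = (1 - gamma) * visits pi p 0 s.
Proof.
rewrite /occupancy; congr (_ * _); rewrite mxE; apply: eq_bigr => x _.
pose e : 'cV[R]_nS := delta_mx s 0.
have eE (M : 'M[R]_nS) : (M *m e) x 0 = M x s.
  rewrite mxE (bigD1 s)//= mxE !eqxx mulr1 big1 ?addr0// => j js.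
  by rewrite mxE (negbTE js) mulr0.
have -> : series (fun t => gamma ^+ t * rho 0 x * step_prob pi p t x s) =
   (fun k => rho 0 x * series (fun t => gamma ^+ t * (trans_mx pi p ^+ t *m e) x 0) k).
  apply/funext => k; rewrite /series/= mulr_sumr; apply: eq_bigr => t _.
  by rewrite eE /step_prob; ring.
apply: cvg_lim => //; rewrite -eE.
apply: cvgM; [exact: cvg_cst | exact: (discounted_series gamma b)].
Qed.

End Contractive.

(* The advantage of the joint step (pi', p') over (pi, p) in state s. *)
Definition adv pi p pi' p' s := \sum_a \sum_y
  (pi' s a * kslice p' s a y - pi s a * kslice p s a y) * cost_to_go pi p s a y.

(** A rewriting of the resolvent identity, with visits under the new pair and costs-to-go under the
    old one. Contractivity suffices, so it applies to difference quotients that leave the simplices;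
    changing both arguments at once serves policies and kernels alike. *)
Lemma performance_difference b b' pi p pi' p' : 0 <= gamma ->
  gamma * b < 1 -> rows_le b (trans_mx pi p) ->
  gamma * b' < 1 -> rows_le b' (trans_mx pi' p') ->
  J gamma rho c pi' p' - J gamma rho c pi p =
    \sum_s visits pi' p' 0 s * adv pi p pi' p' s.
Proof.
move=> g0 gb hb gb' hb'; rewrite (JE b pi p)// (JE b' pi' p')//.
set N := resolvent gamma (trans_mx pi p).
set N' := resolvent gamma (trans_mx pi' p').
have V'E : Vvec pi' p' = N' *m step_cost pi' p' by [].
have VE : Vvec pi p = N *m step_cost pi p by [].
have e : rho *m Vvec pi' p' - rho *m Vvec pi p = visits pi' p' *m
  (step_cost pi' p' - step_cost pi p +
     gamma *: ((trans_mx pi' p' - trans_mx pi p) *m Vvec pi p)).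
  rewrite -mulmxBr /visits -mulmxA; congr (_ *m _).
  have -> : N' *m (step_cost pi' p' - step_cost pi p +
     gamma *: ((trans_mx pi' p' - trans_mx pi p) *m Vvec pi p)) =
     N' *m step_cost pi' p' - N' *m step_cost pi p + (N' - N) *m step_cost pi p.
    rewrite (resolvent_identity gamma b b')// mulmxDr mulmxBr -/N -/N' VE.
    by rewrite -scalemxAr -scalemxAl !mulmxA.
  by rewrite mulmxBl V'E VE addrA subrK.
have sub00 (M M' : 'M[R]_1) : (M - M') 0 0 = M 0 0 - M' 0 0 by rewrite !mxE.
rewrite -sub00 e mxE; apply: eq_bigr => s _; congr (_ * _).
rewrite !mxE.
have -> : \sum_j (trans_mx pi' p' - trans_mx pi p) s j * Vvec pi p j 0 =
  \sum_a \sum_y (pi' s a * kslice p' s a y - pi s a * kslice p s a y) * Vvec pi p y 0.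
  rewrite exchange_big/=; apply: eq_bigr => y _.
  by rewrite -mulr_suml !mxE sumrB.
rewrite mulr_sumr -sumrB -big_split/=; apply: eq_bigr => a _.
rewrite mulr_sumr -sumrB -big_split/=; apply: eq_bigr => y _.
by rewrite /cost_to_go; ring.
Qed.


(** The policy gradient formula as a linear form in the direction; [dJp] is its counterpart for
    kernels. *)
Definition dJpi pi p v := \sum_s visits pi p 0 s * \sum_a v s a * Qval pi p s a.

Definition dJp pi p q := \sum_s visits pi p 0 s *
  \sum_a \sum_y pi s a * kslice q s a y * cost_to_go pi p s a y.

Lemma dJpi_linear pi p (a : R) v w :
  dJpi pi p (a *: v + w) = a * dJpi pi p v + dJpi pi p w.
Proof.
rewrite /dJpi mulr_sumr -big_split; apply: eq_bigr => s _ /=.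
rewrite mulrCA -mulrDr; congr (_ * _); rewrite mulr_sumr -big_split; apply: eq_bigr => i _ /=.
by rewrite !mxE; ring.
Qed.

Lemma dJp_linear pi p (a : R) q r :
  dJp pi p (a *: q + r) = a * dJp pi p q + dJp pi p r.
Proof.
rewrite /dJp mulr_sumr -big_split; apply: eq_bigr => s _ /=.
rewrite mulrCA -mulrDr; congr (_ * _); rewrite mulr_sumr -big_split; apply: eq_bigr => i _ /=.
rewrite mulr_sumr -big_split; apply: eq_bigr => y _ /=.
by rewrite !mxE; ring.
Qed.

Lemma adv_pi pi p w s :
  adv pi p w p s = \sum_a (w - pi) s a * Qval pi p s a.
Proof.
apply: eq_bigr => a _; rewrite mulr_sumr; apply: eq_bigr => y _.
by rewrite [(w - pi) s a]mxE [(- pi) s a]mxE; ring.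
Qed.

Lemma adv_p pi p q s : adv pi p pi q s =
  \sum_a \sum_y pi s a * kslice (q - p) s a y * cost_to_go pi p s a y.
Proof.
by apply: eq_bigr => a _; apply: eq_bigr => y _; rewrite !mxE; ring.
Qed.

Lemma trans_mx_stochastic pi p : policies pi -> kernels p ->
  stochastic (trans_mx pi p).
Proof.
move=> hpi hp.
have pi0 s a : 0 <= pi s a by have [/(_ a)] := hpi s; rewrite mxE.
have p0 s a y : 0 <= kslice p s a y by have [/(_ y)] := hp s a; rewrite mxE.
have pi1 s : \sum_a pi s a = 1.
  by have [_ <-] := hpi s; apply: eq_bigr => a _; rewrite mxE.
have p1 s a : \sum_y kslice p s a y = 1.
  by have [_ <-] := hp s a; apply: eq_bigr => y _; rewrite [RHS]mxE.
split=> [s y|s]; first by rewrite mxE sumr_ge0// => a _; rewrite mulr_ge0.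
rewrite -(pi1 s); under eq_bigr do rewrite mxE.
by rewrite exchange_big/=; apply: eq_bigr => a _; rewrite -mulr_sumr p1 mulr1.
Qed.

Section Simplices.
Context (pi : policy) (p : kernel).
Hypotheses (hg : 0 < gamma < 1) (hpi : policies pi) (hp : kernels p).

Let g0 : 0 <= gamma. Proof. by case/andP: hg => /ltW. Qed.
Let g1 : gamma * 1 < 1. Proof. by case/andP: hg => _; rewrite mulr1. Qed.
Let g1' : 0 < 1 - gamma. Proof. by case/andP: hg => _; rewrite subr_gt0. Qed.
Let rows1 : rows_le 1 (trans_mx pi p).
Proof. exact/stochastic_rows_le/trans_mx_stochastic. Qed.

(** The performance difference is h times the visits at pi + h v paired with a vector that does not
    depend on h, so continuity of the resolvent gives the derivative. *)
Lemma is_derive_J_pi v :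
  is_derive pi v (fun w => J gamma rho c w p) (dJpi pi p v).
Proof.
have [b' gb' near_b'] :=
  rows_le_near gamma 1 (trans_mx pi p) (trans_mx v p) g0 g1 rows1.
pose g : 'cV[R]_nS := \col_s \sum_a v s a * Qval pi p s a.
apply: (is_derive_quotient _ _ _
  (fun h => (rho *m resolvent gamma (trans_mx pi p + h *: trans_mx v p) *m g) 0 0)).
  near=> h.
  have hb' : rows_le b' (trans_mx (pi + h *: v) p).
    by rewrite trans_mx_addl; near: h.
  rewrite (performance_difference 1 b')//.
  rewrite mxE mulr_sumr; apply: eq_bigr => s _.
  rewrite /visits trans_mx_addl adv_pi mulrCA; congr (_ * _).
  rewrite mxE mulr_sumr; apply: eq_bigr => a _.
  by rewrite addrAC subrr add0r mxE mulrA.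
have -> : dJpi pi p v = (rho *m resolvent gamma (trans_mx pi p) *m g) 0 0.
  by rewrite mxE; apply: eq_bigr => s _; rewrite [g s 0]mxE.
exact: resolvent_cvg g0 g1 rows1.
Unshelve. all: by end_near. Qed.

Lemma is_derive_J_p q :
  is_derive p q (fun r => J gamma rho c pi r) (dJp pi p q).
Proof.
have [b' gb' near_b'] :=
  rows_le_near gamma 1 (trans_mx pi p) (trans_mx pi q) g0 g1 rows1.
pose g : 'cV[R]_nS := \col_s \sum_a \sum_y
  pi s a * kslice q s a y * cost_to_go pi p s a y.
apply: (is_derive_quotient _ _ _
  (fun h => (rho *m resolvent gamma (trans_mx pi p + h *: trans_mx pi q) *m g) 0 0)).
  near=> h.
  have hb' : rows_le b' (trans_mx pi (p + h *: q)).
    by rewrite trans_mx_addr; near: h.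
  rewrite (performance_difference 1 b')//.
  rewrite mxE mulr_sumr; apply: eq_bigr => s _.
  rewrite /visits trans_mx_addr adv_p mulrCA; congr (_ * _).
  rewrite mxE mulr_sumr; apply: eq_bigr => a _.
  rewrite mulr_sumr; apply: eq_bigr => y _.
  by rewrite addrAC subrr add0r !mxE; ring.
have -> : dJp pi p q = (rho *m resolvent gamma (trans_mx pi p) *m g) 0 0.
  by rewrite mxE; apply: eq_bigr => s _; rewrite [g s 0]mxE.
exact: resolvent_cvg g0 g1 rows1.
Unshelve. all: by end_near. Qed.

Lemma dotm_grad_pi v :
  dotm (grad (fun w => J gamma rho c w p) pi) v = dJpi pi p v.
Proof. exact: (dotm_grad _ _ (dJpi pi p) is_derive_J_pi (dJpi_linear pi p)). Qed.

Lemma dotm_grad_p q :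
  dotm (grad (fun r => J gamma rho c pi r) p) q = dJp pi p q.
Proof. exact: (dotm_grad _ _ (dJp pi p) is_derive_J_p (dJp_linear pi p)). Qed.

(** rho is the time-zero term of the visits: apply [resolvent_ge] to the indicator of s. This lower
    bound is what lets visits under different pairs be compared through rho. *)
Lemma rho_le_visits s : simplex rho -> rho 0 s <= visits pi p 0 s.
Proof.
move=> [rho0 _]; pose e : 'cV[R]_nS := delta_mx s 0.
have eE (u : 'rV[R]_nS) : (u *m e) 0 0 = u 0 s.
  rewrite mxE (bigD1 s)//= mxE !eqxx mulr1 big1 ?addr0// => j js.
  by rewrite mxE (negbTE js) mulr0.
rewrite -[rho 0 s]eE -[visits pi p 0 s]eE /visits -mulmxA !mxE.
apply: ler_sum => i _; rewrite ler_wpM2l//.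
apply: resolvent_ge; [by case/andP: hg => /ltW -> | exact: trans_mx_stochastic |].
by move=> j; rewrite mxE; case: (_ && _).
Qed.

Lemma visits_sum_le (x : 'cV[R]_nS) B : simplex rho -> (forall s, `|x s 0| <= B) ->
  `|\sum_s visits pi p 0 s * x s 0| <= B / (1 - gamma).
Proof.
move=> [rho0 rho1] hx.
have -> : \sum_s visits pi p 0 s * x s 0 =
    (rho *m (resolvent gamma (trans_mx pi p) *m x)) 0 0 by rewrite mulmxA mxE.
rewrite mxE (le_trans (ler_norm_sum _ _ _))// -[leRHS]mul1r -[X in _ <= X * _]rho1 mulr_suml.
apply: ler_sum => s _; rewrite normrM (ger0_norm (rho0 s)) ler_wpM2l//.
by have := resolvent_bound gamma 1 _ g0 g1 rows1 B x hx s; rewrite mulr1.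
Qed.

Hypothesis hc : forall s a s', 0 <= c s a s' <= 1.

Lemma step_cost_bound s : 0 <= step_cost pi p s 0 <= 1.
Proof.
have pi0 x a : 0 <= pi x a by have [/(_ a)] := hpi x; rewrite mxE.
have p0 x a y : 0 <= kslice p x a y by have [/(_ y)] := hp x a; rewrite mxE.
have [_ P1] := trans_mx_stochastic _ _ hpi hp.
rewrite mxE; apply/andP; split.
  apply: sumr_ge0 => a _; apply: sumr_ge0 => y _.
  by rewrite !mulr_ge0//; case/andP: (hc s a y).
rewrite -(P1 s); under [leRHS]eq_bigr do rewrite mxE.
rewrite [leRHS]exchange_big/=; apply: ler_sum => a _; apply: ler_sum => y _.
by rewrite ler_piMr ?mulr_ge0//; case/andP: (hc s a y).
Qed.

Lemma Vvec_bound s : 0 <= Vvec pi p s 0 <= (1 - gamma)^-1.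
Proof.
have r0 x : 0 <= step_cost pi p x 0 by case/andP: (step_cost_bound x).
apply/andP; split.
  apply: le_trans (r0 s) _; apply: resolvent_ge => //; first by case/andP: hg => /ltW ->.
  exact: trans_mx_stochastic.
have := resolvent_bound gamma 1 _ g0 g1 rows1 1 (step_cost pi p).
rewrite mulr1 mul1r => H; apply: le_trans (ler_norm _) (H _ s) => x.
by rewrite ger0_norm//; case/andP: (step_cost_bound x).
Qed.

Lemma cost_to_go_bound s a y : 0 <= cost_to_go pi p s a y <= (1 - gamma)^-1.
Proof.
have /andP[V0 V1] := Vvec_bound y; have /andP[c0 c1] := hc s a y.
rewrite addr_ge0 ?mulr_ge0//= /cost_to_go.
have : gamma * Vvec pi p y 0 <= gamma * (1 - gamma)^-1 by exact: ler_wpM2l.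
have : (1 - gamma) * (1 - gamma)^-1 = 1 by rewrite mulfV// gt_eqF.
by lra.
Qed.

Lemma Qval_bound s a : 0 <= Qval pi p s a <= (1 - gamma)^-1.
Proof.
have p0 x b y : 0 <= kslice p x b y by have [/(_ y)] := hp x b; rewrite mxE.
have p1 : \sum_y kslice p s a y = 1.
  by have [_ <-] := hp s a; apply: eq_bigr => y _; rewrite [RHS]mxE.
apply/andP; split.
  by apply: sumr_ge0 => y _; rewrite mulr_ge0//; case/andP: (cost_to_go_bound s a y).
rewrite -[leRHS]mul1r -[X in _ <= X * _]p1 mulr_suml; apply: ler_sum => y _.
by rewrite ler_wpM2l//; case/andP: (cost_to_go_bound s a y).
Qed.

Lemma J_bound : simplex rho -> 0 <= J gamma rho c pi p <= (1 - gamma)^-1.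
Proof.
move=> [rho0 rho1]; rewrite (JE 1)// mxE; apply/andP; split.
  by apply: sumr_ge0 => s _; rewrite mulr_ge0//; case/andP: (Vvec_bound s).
rewrite -[leRHS]mul1r -[X in _ <= X * _]rho1 mulr_suml; apply: ler_sum => s _.
by rewrite ler_wpM2l//; case/andP: (Vvec_bound s).
Qed.

Lemma mismatch_bound D s : simplex rho -> (mismatch gamma rho pi p <= D%:E)%E ->
  0 <= D /\ (1 - gamma) * visits pi p 0 s <= D * rho 0 s.
Proof.
move=> hrho /bigmax_leP[D0 hD]; rewrite lee_fin in D0; split => //.
have vs := rho_le_visits s hrho; have [/(_ s) rs0 _] := hrho.
have := hD s isT; rewrite (occupancyE 1)//.
set o := _ * visits pi p 0 s.
have o0 : 0 <= o by rewrite mulr_ge0 ?(ltW g1')// (le_trans rs0).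
(* If rho vanishes at s, the ratio is +oo unless o = 0, so the finite bound D forces o = 0. *)
rewrite inver; case: eqVneq => [r0|r0].
  have [-> _|on0] := eqVneq o 0; first by rewrite mulr_ge0.
  by rewrite gt0_muley ?lte_fin ?lt_def ?on0//.
rewrite -EFinM abse_EFin lee_fin ger0_norm ?divr_ge0//.
by rewrite ler_pdivrMr// lt_def r0.
Qed.

End Simplices.
End MDP.

(** * Gradient dominance *)

Section Dominance.
Context {R : realType} {nS nA : nat} (gamma : R) (rho : 'rV[R]_nS)
  (c : 'I_nS -> 'I_nA -> 'I_nS -> R).
Local Notation policy := 'M[R]_(nS, nA).
Local Notation kernel := 'M[R]_(nS * nA, nS).
Implicit Types (pi w : policy) (p q : kernel).
Hypotheses (hg : 0 < gamma < 1) (hrho : simplex rho)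
  (hc : forall s a s', 0 <= c s a s' <= 1).
Local Notation J := (J gamma rho c).

Let g0 : 0 <= gamma. Proof. by case/andP: hg => /ltW. Qed.
Let g1 : gamma * 1 < 1. Proof. by case/andP: hg => _; rewrite mulr1. Qed.
Let g1' : 0 < 1 - gamma. Proof. by case/andP: hg => _; rewrite subr_gt0. Qed.

Let rows1 pi p : policies pi -> kernels p -> rows_le 1 (trans_mx pi p).
Proof. by move=> ? ?; exact/stochastic_rows_le/trans_mx_stochastic. Qed.

(* The change of measure behind gradient dominance: discarding the negative
   terms first, the visits eta' are traded for eta at the price D / (1 - gamma). *)
Lemma visits_exchange (D : R) (eta eta' a : 'I_nS -> R) :
  (forall s, rho 0 s <= eta s) -> (forall s, rho 0 s <= eta' s) ->
  (forall s, (1 - gamma) * eta' s <= D * rho 0 s) -> 0 <= D ->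
  \sum_s eta' s * a s <=
    D / (1 - gamma) * \sum_s eta s * (if 0 <= a s then a s else 0).
Proof.
have [rho0 _] := hrho.
move=> h h' hD D0; rewrite mulr_sumr; apply: ler_sum => s _.
case: ifP => [a0|/negbT]; last first.
  rewrite -ltNge => /ltW a0; rewrite !mulr0 mulr_ge0_le0//.
  exact: le_trans (rho0 s) (h' s).
rewrite mulrA ler_wpM2r// mulrAC ler_pdivlMr// mulrC.
by apply: le_trans (hD s) _; rewrite ler_wpM2l.
Qed.

(** Glues independent choices made in each state into one kernel; s-rectangularity keeps the result
    in the ambiguity set. *)
Definition kernel_of_slices (f : 'I_nS -> 'M[R]_(nA, nS)) : kernel :=
  \matrix_(k, y) mxvec (\matrix_(s, a) f s a y) 0 k.

Lemma kslice_of_slices f s : kslice (kernel_of_slices f) s = f s.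
Proof. by apply/matrixP => a y; rewrite !mxE mxvecE mxE. Qed.

(** The witness q follows p' exactly in the states where this has nonnegative advantage and keeps p
    elsewhere. Its directional derivative is then the visit-weighted positive part of the advantage,
    which is the right-hand side of [visits_exchange]. *)
Lemma dominance_kernel (P : set kernel) D pi p p' :
  P `<=` @kernels R nS nA -> s_rectangular P -> policies pi -> P p -> P p' ->
  (mismatch gamma rho pi p' <= D%:E)%E ->
  exists2 q, P q & J pi p' - J pi p <=
    D / (1 - gamma) * dotm (grad (fun r => J pi r) p) (q - p).
Proof.
move=> sP [Ps PE] hpi Pp Pp' hD; have hp := sP _ Pp; have hp' := sP _ Pp'.
pose A s := adv gamma c pi p pi p' s.
pose q := kernel_of_slices (fun s => if 0 <= A s then kslice p' s else kslice p s).
exists q.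
  rewrite PE /= => s; rewrite kslice_of_slices; move: Pp Pp'; rewrite PE /=.
  by case: ifP.
rewrite (performance_difference _ _ _ 1 1)//; try exact: rows1.
rewrite dotm_grad_p//.
have [D0 hv] : 0 <= D /\ forall s,
    (1 - gamma) * visits gamma rho pi p' 0 s <= D * rho 0 s.
  split; last by move=> s; apply: (mismatch_bound _ _ _ _ hg hpi hp' _ s hrho hD).2.
  by case/bigmax_leP: hD; rewrite lee_fin.
apply: le_trans (visits_exchange D (visits gamma rho pi p 0) _ A _ _ hv D0) _.
- by move=> s; exact: rho_le_visits.
- by move=> s; exact: rho_le_visits.
rewrite ler_wpM2l//; first by rewrite divr_ge0 ?(ltW g1').
apply: ler_sum => s _; rewrite -adv_p; apply: ler_wpM2l.
  by have [r0 _] := hrho; apply: le_trans (r0 s) (rho_le_visits _ _ _ _ hg _ _ _ _).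
rewrite /adv kslice_of_slices; case: ifP => // _.
apply: sumr_ge0 => a _; apply: sumr_ge0 => y _.
by rewrite subrr mul0r.
Qed.

(** The same switch, with the sign reversed since policies minimize: u copies w only where this does
    not increase the cost. Policies form a product over states, so u is again a policy. *)
Lemma dominance_policy D pi w p :
  policies pi -> policies w -> kernels p ->
  (mismatch gamma rho w p <= D%:E)%E ->
  exists2 u, policies u & J pi p - J w p <=
    D / (1 - gamma) * dotm (grad (fun v => J v p) pi) (pi - u).
Proof.
move=> hpi hw hp hD.
pose A s := - adv gamma c pi p w p s.
pose u : policy := \matrix_(s, a) if 0 <= A s then w s a else pi s a.
have urow s : row s u = if 0 <= A s then row s w else row s pi.
  by apply/rowP => a; rewrite !mxE; case: ifP; rewrite mxE.
exists u; first by move=> s; rewrite urow; case: ifP.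
rewrite -opprB (performance_difference _ _ _ 1 1)//; try exact: rows1.
rewrite dotm_grad_pi//.
have [D0 hv] : 0 <= D /\ forall s,
    (1 - gamma) * visits gamma rho w p 0 s <= D * rho 0 s.
  split; last by move=> s; apply: (mismatch_bound _ _ _ _ hg hw hp _ s hrho hD).2.
  by case/bigmax_leP: hD; rewrite lee_fin.
rewrite -sumrN; under eq_bigr do rewrite -mulrN.
apply: le_trans (visits_exchange D (visits gamma rho pi p 0) _ A _ _ hv D0) _.
- by move=> s; exact: rho_le_visits.
- by move=> s; exact: rho_le_visits.
rewrite ler_wpM2l//; first by rewrite divr_ge0 ?(ltW g1').
apply: ler_sum => s _; apply: ler_wpM2l.
  by have [r0 _] := hrho; apply: le_trans (r0 s) (rho_le_visits _ _ _ _ hg _ _ _ _).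
have e : \sum_a (pi - u) s a * Qval gamma c pi p s a = if 0 <= A s then A s else 0.
  case: ifP => As.
  - rewrite /A adv_pi -sumrN; apply: eq_bigr => a _.
    by rewrite !mxE As; ring.
  - by rewrite big1// => a _; rewrite !mxE As subrr mul0r.
by rewrite e.
Qed.

(** One factor 1 / (1 - gamma) bounds the Q-values, the other the total number of visits; nA counts
    the entries of a row. *)
Lemma J_policy_lipschitz pi pi' p : policies pi -> policies pi' -> kernels p ->
  J pi' p - J pi p <= nA%:R / (1 - gamma) ^+ 2 * frob (pi' - pi).
Proof.
move=> hpi hpi' hp.
rewrite (performance_difference _ _ _ 1 1)//; try exact: rows1.
pose x : 'cV[R]_nS := \col_s adv gamma c pi p pi' p s.
have -> : \sum_s visits gamma rho pi' p 0 s * adv gamma c pi p pi' p s =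
    \sum_s visits gamma rho pi' p 0 s * x s 0.
  by apply: eq_bigr => s _; rewrite [x s 0]mxE.
apply: le_trans (ler_norm _) _.
have hx s : `|x s 0| <= nA%:R * frob (pi' - pi) / (1 - gamma).
  rewrite mxE adv_pi (le_trans (ler_norm_sum _ _ _))//.
  rewrite -mulrA mulr_natl -[X in _ *+ X]card_ord -sumr_const.
  apply: ler_sum => a _; rewrite normrM ler_pM//; first exact: entry_le_frob.
  have /andP[Q0 Q1] := Qval_bound _ _ _ _ hg hpi hp hc s a.
  by rewrite ger0_norm.
apply: le_trans (visits_sum_le _ _ _ _ hg hpi' hp _ _ hrho hx) _.
by rewrite expr2 invfM le_eqVlt; apply/orP; left; apply/eqP; ring.
Qed.

End Dominance.

(** * Minimization over policies *)

Lemma entry_le_norm {R : realType} {m n} (M : 'M[R]_(m, n)) i j : `|M i j| <= `|M|.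
Proof.
rewrite [leRHS]/Num.Def.normr /= mx_normrE; apply/bigmax_geP; right.
by exists (i, j).
Qed.

Lemma within_continuous_of_lipschitz {R : realType} {n} (A : set 'rV[R]_n)
    (g : 'rV[R]_n -> R) (C : R) :
  (forall v w, A v -> A w -> g w - g v <= C * `|w - v|) -> {within A, continuous g}.
Proof.
move=> hg; apply/subspace_continuousP => v Av; apply/cvgrPdist_le => e e0.
have C1 : 0 < `|C| + 1 by rewrite ltr_wpDl.
rewrite near_withinE; near=> w => Aw.
have hw : `|w - v| <= e / (`|C| + 1).
  rewrite distrC; near: w.
  by apply: cvgr_dist_le; [exact: cvg_id | rewrite divr_gt0].
have hC : C * `|w - v| <= e.
  rewrite ler_pdivlMr// mulrC in hw; apply: le_trans hw.
  by rewrite ler_wpM2r// (le_trans (ler_norm _))// lerDl.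
rewrite ler_norml lerNl opprB.
have := hg _ _ Av Aw; have := hg _ _ Aw Av; rewrite distrC => h1 h2.
by rewrite (le_trans h2 hC)/= (le_trans h1 hC).
Unshelve. all: by end_near. Qed.

Section Policies.
Context {R : realType} {nS nA : nat}.
Local Notation Pi := (@policies R nS nA).
Implicit Types (x y z : 'M[R]_(nS, nA)).

Lemma policies_entry x s a : Pi x -> 0 <= x s a <= 1.
Proof.
move=> hx; have [h0 h1] := hx s.
have x0 b : 0 <= x s b by have := h0 b; rewrite mxE.
rewrite x0 -[leRHS]h1 (bigD1 a)//= mxE lerDl sumr_ge0// => b _; by rewrite mxE.
Qed.

Lemma policies_segment : segment_closed Pi.
Proof.
move=> x y t hx hy /andP[t0 t1] s.
have [x0 x1] := hx s; have [y0 y1] := hy s; split.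
  move=> a; have := x0 a; have := y0 a; rewrite !mxE => ya xa.
  have : 0 <= (1 - t) * x s a + t * y s a.
    by rewrite addr_ge0// mulr_ge0// subr_ge0.
  by lra.
have -> : \sum_i row s (x + t *: (y - x)) 0 i =
   (1 - t) * \sum_i row s x 0 i + t * \sum_i row s y 0 i.
  rewrite !mulr_sumr -big_split; apply: eq_bigr => i _ /=; rewrite !mxE; ring.
by rewrite x1 y1; ring.
Qed.

Lemma policies_frob x y : Pi x -> Pi y -> frob (x - y) <= nS%:R * nA%:R.
Proof.
move=> hx hy; rewrite -[leRHS]mulr1; apply: frob_le_const => // s a.
have := policies_entry x s a hx; have := policies_entry y s a hy.
by rewrite !mxE ler_norml; lra.
Qed.

Lemma policies_min (f : 'M[R]_(nS, nA) -> R) (C : R) : 0 <= C -> Pi !=set0 ->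
  (forall x y, Pi x -> Pi y -> f y - f x <= C * frob (y - x)) ->
  exists x, is_min Pi f x.
Proof.
move=> C0 [x0 hx0] hf.
(* Policies are flattened to row vectors, where closed and bounded sets are compact. *)
pose A := [set v : 'rV[R]_(nS * nA) | Pi (vec_mx v)].
have A0 : A !=set0 by exists (mxvec x0); rewrite /A/= mxvecK.
have bA : bounded_set A.
  exists 1; split; first exact: num_real.
  move=> M M1 v Av; apply: le_trans (ltW M1).
  rewrite [leLHS]/Num.Def.normr /= mx_normrE; apply/bigmax_leP; split => // -[i k] _ /=.
  rewrite (ord1 i); case/mxvec_indexP: k => s a.
  have := policies_entry _ s a Av; rewrite mxE => /andP[h0 h1].
  by rewrite ger0_norm.
have cA : closed A.
  have -> : A = (\bigcap_(i in [set: 'I_nS * 'I_nA])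
        [set v : 'rV[R]_(nS * nA) | 0 <= v 0 (mxvec_index i.1 i.2)]) `&`
     \bigcap_(s in [set: 'I_nS])
        [set v : 'rV[R]_(nS * nA) | \sum_a v 0 (mxvec_index s a) = 1].
    apply/seteqP; split => v /=.
      move=> Av; split => [[s a] _|s _] /=.
        by have := policies_entry _ s a Av; rewrite mxE => /andP[].
      by have [_ <-] := Av s; apply: eq_bigr => a _; rewrite !mxE.
    move=> [h0 h1] s; split => [a|].
      by rewrite !mxE; apply: (h0 (s, a)).
    by rewrite -[RHS](h1 s)//; apply: eq_bigr => a _; rewrite !mxE.
  apply: closedI; apply: closed_bigI => i _.
    apply: (@preimage_closed _ _ (fun v : 'rV[R]_(nS * nA) => v 0 _) [set x | 0 <= x]).
      by move=> v _; exact: coord_continuous.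
    exact: closed_ge.
  apply: (@preimage_closed _ _
    (fun v : 'rV[R]_(nS * nA) => \sum_a v 0 (mxvec_index i a)) [set x | x = 1]).
    move=> v _; apply: cvg_big; [exact: add_continuous | exact: nbhs_filter |].
    by move=> a _; exact: coord_continuous.
  exact: closed_eq.
have cf : {within A, continuous (fun v => f (vec_mx v))}.
  apply: (@within_continuous_of_lipschitz _ _ _ _ (C * (nS%:R * nA%:R))) => v w Av Aw.
  apply: le_trans (hf _ _ Av Aw) _; rewrite -mulrA ler_wpM2l//.
  apply: frob_le_const => // s a.
  have -> : (vec_mx w - vec_mx v) s a = (w - v) 0 (mxvec_index s a) by rewrite !mxE.
  exact: entry_le_norm.
have [v vA hv] := compact_EVT_min A0 (bounded_closed_compact bA cA) cf.
exists (vec_mx v); split; first by move: vA; rewrite inE.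
move=> y hy; have := hv (mxvec y); rewrite mxvecK; apply.
by rewrite inE /A /= mxvecK.
Qed.

End Policies.

(** * Smoothness along segments *)

Lemma increment_le {R : realType} (h dh : R -> R) (a b : R) :
  (forall t : R, 0 <= t <= 1 -> is_derive t 1 h (dh t)) ->
  (forall t : R, 0 <= t <= 1 -> dh t <= a + b * t) -> h 1 - h 0 <= a + b / 2.
Proof.
move=> dP le_dh.
(* Subtracting the primitive of the bound leaves a function with nonpositive derivative, to which
   the mean value theorem applies. *)
pose k t : R := h t - (a * t + b / 2 * t ^+ 2).
have dk (t : R) : 0 <= t <= 1 -> is_derive t 1 k (dh t - (a + b * t)).
  move=> t01; have ? := dP t t01.
  apply: is_derive_eq.
  transitivity (dh t - (a * 1 + (b / 2) * (t * 1 + t * 1)) : R); first by [].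
  by field.
have [||t tin e] := @MVT R k (fun t => dh t - (a + b * t)) 0 1 ltr01.
- by move=> t; rewrite in_itv/= => /andP[t0 t1]; apply: dk; rewrite !ltW.
- apply: derivable_within_continuous => t; rewrite in_itv/= => t01.
  by have ? := dk t t01; exact: ex_derive.
move: tin; rewrite in_itv/= => /andP[t0 t1].
have t01 : 0 <= t <= 1 by rewrite !ltW.
have := le_dh t t01.
move: e; rewrite /k; lra.
Qed.

Section Segments.
Context {R : realType} {m n : nat} (X : set 'M[R]_(m, n)).
Implicit Types (F : 'M[R]_(m, n) -> R) (x y d : 'M[R]_(m, n)).
Hypothesis cX : segment_closed X.

Lemma is_derive_segment F x d (t : R) D : is_derive (x + t *: d) d F D ->
  is_derive t 1 (fun s => F (x + s *: d)) D.
Proof.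
move=> [ex val].
have e : (fun h => h^-1 *:
      (((fun s => F (x + s *: d)) \o shift t) (h *: 1) - F (x + t *: d))) =
   (fun h => h^-1 *: ((F \o shift (x + t *: d)) (h *: d) - F (x + t *: d))).
  apply/funext => h; congr (_ *: (_ - _)) => /=; congr F.
  by rewrite -[h *: 1]/(h * 1) mulr1 scalerDl addrCA addrA.
by split; [rewrite /derivable e | rewrite /derive e].
Qed.

Definition smooth_on F (g : 'M[R]_(m, n) -> 'M[R]_(m, n)) (l : R) :=
  forall x y, X x -> X y ->
    `|F y - F x - dotm (g x) (y - x)| <= l / 2 * frob (y - x) ^+ 2.

Lemma smooth_on_of_lipschitz F g l :
  (forall x d, X x -> is_derive x d F (dotm (g x) d)) ->
  (forall x y, X x -> X y -> frob (g x - g y) <= l * frob (x - y)) ->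
  smooth_on F g l.
Proof.
move=> dF lip x y Xx Xy; set d := y - x.
have xt t : 0 <= t <= 1 -> X (x + t *: d) by exact: cX.
have dseg (t : R) : 0 <= t <= 1 ->
    is_derive t 1 (fun s => F (x + s *: d)) (dotm (g (x + t *: d)) d).
  by move=> t01; apply/is_derive_segment/dF/xt.
have near t : 0 <= t <= 1 ->
    `|dotm (g (x + t *: d)) d - dotm (g x) d| <= l * frob d ^+ 2 * t.
  move=> t01; have -> : l * frob d ^+ 2 * t = l * (t * frob d) * frob d by ring.
  have glip : frob (g (x + t *: d) - g x) <= l * (t * frob d).
    apply: le_trans (lip _ _ (xt t t01) Xx) _.
    by rewrite addrAC subrr add0r frobZ//; case/andP: t01.
  rewrite -dotmNl -dotmDl ler_norml lerNl -dotmNl.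
  rewrite !dotm_le_of// ?frobN//.
have e0 : F x = F (x + 0 *: d) by rewrite scale0r addr0.
have e1 : F y = F (x + 1 *: d) by rewrite scale1r /d addrC subrK.
have hi : F y - F x <= dotm (g x) d + l * frob d ^+ 2 / 2.
  rewrite e0 e1; apply: (increment_le (fun s => F (x + s *: d)) _ _ _ dseg) => t t01.
  by have := near t t01; rewrite ler_norml; lra.
have lo : - F y - - F x <= - dotm (g x) d + l * frob d ^+ 2 / 2.
  rewrite e0 e1; apply: (increment_le (fun s => - F (x + s *: d))
    (fun t => - dotm (g (x + t *: d)) d)) => t t01.
    by have ? := dseg t t01; apply: is_deriveN.
  by have := near t t01; rewrite ler_norml; lra.
by rewrite ler_norml; lra.
Qed.

(** Meant for F1 = J(., y) and F2 = J(., y'): it bounds the mixed second difference of J using only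
    first derivatives. *)
Lemma increment_difference_le F1 F2 g1 g2 (C : R) x y : X x -> X y ->
  (forall x d, X x -> is_derive x d F1 (dotm (g1 x) d)) ->
  (forall x d, X x -> is_derive x d F2 (dotm (g2 x) d)) ->
  (forall x, X x -> frob (g1 x - g2 x) <= C) ->
  (F1 y - F2 y) - (F1 x - F2 x) <= C * frob (y - x).
Proof.
move=> Xx Xy d1 d2 hC; set d := y - x.
have xt t : 0 <= t <= 1 -> X (x + t *: d) by exact: cX.
have := increment_le (fun s => F1 (x + s *: d) - F2 (x + s *: d))
  (fun t => dotm (g1 (x + t *: d)) d - dotm (g2 (x + t *: d)) d) (C * frob d) 0.
rewrite !scale1r !scale0r !addr0 mul0r addr0 [x + d]addrC subrK; apply.
  move=> t t01; have ? := is_derive_segment _ _ _ _ _ (d1 _ d (xt t t01)).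
  have ? := is_derive_segment _ _ _ _ _ (d2 _ d (xt t t01)).
  exact: is_deriveB.
move=> t t01; rewrite mul0r addr0 -dotmNl -dotmDl.
by apply: dotm_le_of => //; exact/hC/xt.
Qed.

(** Smoothness gives quadratic lower bounds at the intermediate point w; in their convex combination
    the linear terms cancel, and the regularizer outweighs the loss l by r - l. *)
Lemma strongly_convex_smooth F g l (r : R) z : smooth_on F g l ->
  strongly_convex X (fun x => F x + r / 2 * frob (x - z) ^+ 2) (r - l).
Proof.
move=> sF x y t Xx Xy t01; have Xw := cX x y t Xx Xy t01.
set w := x + t *: (y - x) in Xw *.
have := sF w x Xw Xx; have := sF w y Xw Xy; rewrite !ler_norml !frob_sq.
have -> : y - w = (1 - t) *: (y - x).
  by rewrite /w opprD addrA scalerBl scale1r.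
have -> : x - w = (- t) *: (y - x) by rewrite /w opprD addrA subrr add0r scaleNr.
have -> : w - z = (x - z) + t *: (y - x) by rewrite /w addrAC.
have -> : y - z = (x - z) + (y - x) by rewrite [RHS]addrC addrA subrK.
move: (y - x) (x - z) => d e; rewrite !dotmE (dotmC d e).
move: (dotm (g w) d) (dotm e e) (dotm e d) (dotm d d) => a ee ed dd.
case/andP: t01 => t0 t1 /andP[h1 _] /andP[h2 _].
have := ler_wpM2l t0 h1.
have : 0 <= 1 - t by rewrite subr_ge0.
move=> /ler_wpM2l/(_ _ _ h2); nra.
Qed.

(** The index that attains F at the convex combination works for the whole inequality, since its
    function lies below F at both endpoints. *)
Lemma strongly_convex_sup {T : Type} (S : set T) (f : 'M[R]_(m, n) -> T -> R) F k :
  (forall x s, X x -> S s -> f x s <= F x) ->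
  (forall x, X x -> exists2 s, S s & F x = f x s) ->
  (forall s, S s -> strongly_convex X (f^~ s) k) -> strongly_convex X F k.
Proof.
move=> hle hatt sc x y t Xx Xy t01.
have [s Ss ->] := hatt _ (cX x y t Xx Xy t01).
apply: le_trans (sc s Ss x y t Xx Xy t01) _; case/andP: t01 => t0 t1.
have t1' : 0 <= 1 - t by rewrite subr_ge0.
have := ler_wpM2l t0 (hle y s Xy Ss); have := ler_wpM2l t1' (hle x s Xx Ss).
by lra.
Qed.

End Segments.

Lemma dotm_delta {R : realType} {m n} (A : 'M[R]_(m, n)) i j :
  dotm A (delta_mx i j) = A i j.
Proof.
rewrite /dotm (bigD1 i)//= (bigD1 j)//= !mxE !eqxx mulr1.
rewrite big1 => [|k kj]; last by rewrite mxE (negbTE kj) andbF mulr0.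
rewrite big1 ?addr0// => k ki; apply: big1 => l _.
by rewrite mxE (negbTE ki) mulr0.
Qed.

(** * Lyapunov descent *)

#[local] Opaque dotm frob.

Lemma frob_sq_shift {R : realType} {m n} (a b z : 'M[R]_(m, n)) :
  frob (b - z) ^+ 2 =
    frob (a - z) ^+ 2 + 2 * dotm (a - z) (b - a) + frob (b - a) ^+ 2.
Proof.
have -> : b - z = (a - z) + (b - a) by rewrite [RHS]addrC addrA subrK.
by move: (a - z) (b - a) => s t; rewrite !frob_sq !dotmE (dotmC t s); ring.
Qed.

(** A change of center acts on a through a linear term only; the rest is free of a and cancels when
    two points are compared. *)
Lemma frob_sq_recenter {R : realType} {m n} (a z z' : 'M[R]_(m, n)) :
  frob (a - z') ^+ 2 =
    frob (a - z) ^+ 2 + dotm z' z' - dotm z z - 2 * dotm a (z' - z).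
Proof. by rewrite !frob_sq !dotmE (dotmC z a) (dotmC z' a); ring. Qed.

Lemma proj_step {R : realType} {m n} (X : set 'M[R]_(m, n)) (t : R)
    (x g x' w : 'M[R]_(m, n)) :
  0 < t -> segment_closed X -> is_proj X (x - t *: g) x' -> X w ->
  t^-1 * dotm (x - x') (w - x') <= dotm g (w - x').
Proof.
move=> t0 cX hp Xw; have := proj_dotm_le _ _ _ cX hp w Xw.
have -> : x - t *: g - x' = (x - x') - t *: g by rewrite addrAC.
rewrite [dotm (_ - t *: g) _]dotmDl dotmNl dotmZl => h.
by rewrite ler_pdivrMl//; lra.
Qed.

Lemma le_of_sq_le {R : realType} (k a b : R) :
  0 < k -> 0 <= a -> 0 <= b -> k * a ^+ 2 <= b * a -> k * a <= b.
Proof.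
move=> k0 a0 b0; have [->|an0] := eqVneq a 0; first by rewrite !mulr0.
by rewrite expr2 mulrA ler_pM2r// lt_def an0.
Qed.

(** Index 0 is excluded, and K >= 2 leaves K - 1 >= K / 2 terms, whence the factor 2. *)
Lemma exists_le_average {R : realType} (T : nat -> R) K S :
  (2 <= K)%N -> (forall k, 0 <= T k) -> \sum_(i < K) T i <= S ->
  exists2 k, (0 < k < K)%N & K%:R * T k <= 2 * S.
Proof.
case: K => // K K1 T0 hS; apply: contrapT => hno.
have big (i : 'I_K) : 2 * S < K.+1%:R * T i.+1.
  by rewrite ltNge; apply/negP => h; apply: hno; exists i.+1 => //=; rewrite ltnS.
have S0 : 0 <= S by apply: le_trans hS; apply: sumr_ge0.
have lt_sum : \sum_(i < K) 2 * S < \sum_(i < K) K.+1%:R * T i.+1.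
  by apply: ltr_sum => //; apply/hasP; exists (Ordinal (K1 : (0 < K)%N)).
have le_sum : \sum_(i < K) K.+1%:R * T i.+1 <= K.+1%:R * S.
  rewrite -mulr_sumr ler_wpM2l//; apply: le_trans hS.
  by rewrite big_ord_recl/= lerDr.
have : 2 * K%:R * S < (K%:R + 1) * S.
  have := lt_le_trans lt_sum le_sum.
  by rewrite sumr_const card_ord -mulr_natl -natr1 => h; lra.
have K1' : 1 <= K%:R :> R by rewrite ler1n.
have : 0 <= S * (K%:R - 1) by rewrite mulr_ge0// subr_ge0.
by lra.
Qed.

(** * Descent for an abstract smooth objective with gradient dominance *)

Section Descent.
Context {R : realType} {m n p q : nat}.
Local Notation MX := 'M[R]_(m, n).
Local Notation MY := 'M[R]_(p, q).
Context (X : set MX) (Y : set MY) (f : MX -> MY -> R)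
  (gx : MX -> MY -> MX) (gy : MX -> MY -> MY) (fm : MX -> R)
  (L l r1 r2 tau sigma kappa mu : R).
Hypotheses (cX : segment_closed X) (cY : segment_closed Y).
Hypotheses (L0 : 0 < L) (l0 : 0 < l) (r1L : 2 * L <= r1) (r20 : 0 < r2)
  (tau0 : 0 < tau) (sigma0 : 0 < sigma).
Hypothesis tauL : 3 * (L + r1) <= 4 * tau^-1.
Hypothesis taul : 6 * l <= tau^-1.
Hypothesis kappaE : (r1 - L) * kappa = 2 * r1 + tau^-1.
Hypothesis sigmak : 3 * l * kappa ^+ 2 <= 2 * sigma^-1.
Hypothesis sigmal : 12 * l + 6 * r2 <= sigma^-1.
Hypothesis mu01 : 0 < mu < 1.
Hypothesis fx_smooth : forall y, Y y -> smooth_on X (f^~ y) (gx^~ y) L.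
Hypothesis fy_smooth : forall x, X x -> smooth_on Y (f x) (gy x) l.
Hypothesis gx_lip : forall x x' y y', X x -> X x' -> Y y -> Y y' ->
  frob (gx x y - gx x' y') <= L * (frob (x - x') + frob (y - y')).
Hypothesis gy_lip : forall x x' y y', X x -> X x' -> Y y -> Y y' ->
  frob (gy x y - gy x' y') <= l * (frob (x - x') + frob (y - y')).
Hypothesis f_cross : forall x x' y y', X x -> X x' -> Y y -> Y y' ->
  (f x' y - f x' y') - (f x y - f x y') <= L * frob (y - y') * frob (x' - x).
Hypothesis f_le_fm : forall x y, X x -> Y y -> f x y <= fm x.
Hypothesis fm_attained : forall x, X x -> exists2 y, Y y & fm x = f x y.

Let m0 : 0 < r1 - L. Proof. by move: L0 r1L; lra. Qed.
Let r12 : r1 <= (r1 - L) * 2. Proof. by move: r1L; lra. Qed.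
Let r10 : 0 <= r1. Proof. by move: L0 r1L; lra. Qed.
Let ti0 : 0 < tau^-1. Proof. by rewrite invr_gt0. Qed.
Let si0 : 0 < sigma^-1. Proof. by rewrite invr_gt0. Qed.
Let kappa0 : 0 <= kappa.
Proof. by rewrite -(pmulr_rge0 _ m0) kappaE; move: r10 ti0; lra. Qed.

Definition Freg x y z := f x y + r1 / 2 * frob (x - z) ^+ 2.
Definition fmreg x z := fm x + r1 / 2 * frob (x - z) ^+ 2.

(** A chosen minimizer; the default 0 is never met for y in Y and z in X, by [xmin_ex]. Likewise
    [xprox] is the proximal point of the weakly convex [fm]. *)
Definition xmin y z := xget 0 [set x | is_min X (fun x => Freg x y z) x].
Definition xprox z := xget 0 [set x | is_min X (fun x => fmreg x z) x].

Hypothesis xmin_ex : forall y z, Y y -> X z -> exists x, is_min X (fun x => Freg x y z) x.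
Hypothesis xprox_ex : forall z, X z -> exists x, is_min X (fun x => fmreg x z) x.

Lemma xminP y z : Y y -> X z -> is_min X (fun x => Freg x y z) (xmin y z).
Proof. by move=> Yy Xz; apply: (xgetPex 0 (xmin_ex y z Yy Xz)). Qed.

Lemma xproxP z : X z -> is_min X (fun x => fmreg x z) (xprox z).
Proof. by move=> Xz; apply: (xgetPex 0 (xprox_ex z Xz)). Qed.

Lemma xmin_in y z : Y y -> X z -> X (xmin y z).
Proof. by move=> Yy Xz; case: (xminP y z Yy Xz). Qed.

Lemma xprox_in z : X z -> X (xprox z).
Proof. by move=> Xz; case: (xproxP z Xz). Qed.

Lemma Freg_strongly_convex y z : Y y ->
  strongly_convex X (fun x => Freg x y z) (r1 - L).
Proof. by move=> Yy; apply: strongly_convex_smooth => //; exact: fx_smooth. Qed.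

Lemma fmreg_strongly_convex z : strongly_convex X (fun x => fmreg x z) (r1 - L).
Proof.
apply: (strongly_convex_sup _ cX Y (fun x y => Freg x y z)).
- by move=> x y Xx Yy; rewrite lerD2r f_le_fm.
- by move=> x Xx; have [y Yy e] := fm_attained x Xx; exists y => //; rewrite /fmreg e.
- by move=> y Yy; exact: Freg_strongly_convex.
Qed.

Lemma xmin_growth y z x : Y y -> X z -> X x ->
  Freg (xmin y z) y z + (r1 - L) / 2 * frob (x - xmin y z) ^+ 2 <= Freg x y z.
Proof.
move=> Yy Xz Xx.
exact: (min_quad_growth _ _ _ _ _ cX (Freg_strongly_convex y z Yy) (xminP y z Yy Xz) Xx).
Qed.

(** Adding the growth inequalities of the two minimizers leaves the mixed difference of f, so (r1 -
    L) d <= L e; r1 >= 2 L turns this into constant 1. *)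
Lemma xmin_lipschitz_y y y' z : Y y -> Y y' -> X z ->
  frob (xmin y' z - xmin y z) <= frob (y' - y).
Proof.
move=> Yy Yy' Xz; have X1 := xmin_in y z Yy Xz; have X2 := xmin_in y' z Yy' Xz.
have h1 := xmin_growth y z _ Yy Xz X2; have h2 := xmin_growth y' z _ Yy' Xz X1.
have h3 := f_cross _ _ _ _ X1 X2 Yy Yy'.
rewrite (frobBC (xmin y z)) in h2; rewrite (frobBC y y') in h3.
move: h1 h2 h3; rewrite /Freg; set d := frob (xmin y' z - _); set e := frob (y' - y).
move=> h1 h2 h3.
have e0 : 0 <= e := frob_ge0 _; have d0 : 0 <= d := frob_ge0 _.
have h : (r1 - L) * d <= L * e.
  by apply: le_of_sq_le => //; [rewrite mulr_ge0// ltW | lra].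
by rewrite -(ler_pM2l m0); apply: le_trans h _; rewrite ler_wpM2r//; move: r1L; lra.
Qed.

(** As for y, but the mixed term is now r1 times an inner product, and r1 <= 2 (r1 - L). *)
Lemma xmin_lipschitz_z y z z' : Y y -> X z -> X z' ->
  frob (xmin y z' - xmin y z) <= 2 * frob (z' - z).
Proof.
move=> Yy Xz Xz'; have X1 := xmin_in y z Yy Xz; have X2 := xmin_in y z' Yy Xz'.
have h1 := xmin_growth y z _ Yy Xz X2; have h2 := xmin_growth y z' _ Yy Xz' X1.
rewrite (frobBC (xmin y z)) in h2.
have h3 := dotm_le (xmin y z' - xmin y z) (z' - z).
move: h1 h2 h3; rewrite /Freg; move: X1 X2.
move: (xmin y z) (xmin y z') => a b Xa Xb.
have d0 : 0 <= frob (b - a) := frob_ge0 _.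
have e0 : 0 <= frob (z' - z) := frob_ge0 _.
rewrite (frob_sq_recenter b z z') (frob_sq_recenter a z z').
rewrite [dotm (b - a) _]dotmDl dotmNl => h1 h2 h3.
have h : (r1 - L) * frob (b - a) <= r1 * frob (z' - z).
  apply: le_of_sq_le => //; first by rewrite mulr_ge0.
  have : r1 * (dotm b (z' - z) - dotm a (z' - z)) <= r1 * (frob (b - a) * frob (z' - z)).
    by rewrite ler_wpM2l.
  by lra.
rewrite -(ler_pM2l m0); apply: le_trans h _.
by rewrite mulrA ler_wpM2r.
Qed.

Context (B Cx Cy dX dY lip : R).
Hypothesis f_bound : forall x y, X x -> Y y -> 0 <= f x y <= B.
Hypotheses (Cx0 : 0 <= Cx) (Cy0 : 0 <= Cy) (dX0 : 0 <= dX) (dY0 : 0 <= dY)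
  (lip0 : 0 <= lip).
Hypothesis diamX : forall x x', X x -> X x' -> frob (x - x') <= dX.
Hypothesis diamY : forall y y', Y y -> Y y' -> frob (y - y') <= dY.
Hypothesis fm_lip : forall x x', X x -> X x' -> fm x' - fm x <= lip * frob (x' - x).
Hypothesis dominance_y : forall x y, X x -> Y y ->
  exists2 y', Y y' & fm x - f x y <= Cy * dotm (gy x y) (y' - y).
Hypothesis dominance_x : forall x y w, X x -> Y y -> X w ->
  exists2 x', X x' & f x y - fm w <= Cx * dotm (gx x y) (x - x').

Definition prox_const :=
  2 / (r1 - L) * (Cy * dY * (l * kappa + 2 * l + r2 + sigma^-1)).
Definition gap_const :=
  lip + Cy * dY * (l + r2 + sigma^-1) + Cx * dX * (tau^-1 + L + r1).

(** * One iteration *)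

Section OneStep.
Context (x x' z z' : MX) (y y' v v' : MY) (beta : R).
Hypotheses (Xx : X x) (Xz : X z) (Yy : Y y).
Hypothesis beta01 : 0 < beta <= 1 / 15.
Hypothesis stepx : is_proj X (x - tau *: (gx x y + r1 *: (x - z))) x'.
Hypothesis stepy : is_proj Y (y + sigma *: (gy x' y - r2 *: (y - v))) y'.
Hypothesis stepz : z' = z + beta *: (x' - z).
Hypothesis stepv : v' = v + mu *: (y' - v).

Let Xx' : X x'. Proof. by case: stepx. Qed.
Let Yy' : Y y'. Proof. by case: stepy. Qed.
Let Xz' : X z'.
Proof.
by rewrite stepz; apply: cX => //; case/andP: beta01 => b0 b1; rewrite ltW//=; lra.
Qed.

Let dx := frob (x' - x).
Let dy := frob (y' - y).
Let w := frob (y' - v).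
Let u := frob (x' - z).

Let dx0 : 0 <= dx. Proof. exact: frob_ge0. Qed.
Let dy0 : 0 <= dy. Proof. exact: frob_ge0. Qed.
Let w0 : 0 <= w. Proof. exact: frob_ge0. Qed.
Let u0 : 0 <= u. Proof. exact: frob_ge0. Qed.

Lemma step_x_optimality t : X t ->
  tau^-1 * dotm (x - x') (t - x') <= dotm (gx x y + r1 *: (x - z)) (t - x').
Proof. by move=> Xt; apply: proj_step stepx Xt. Qed.

Lemma step_y_optimality t : Y t ->
  sigma^-1 * dotm (y - y') (t - y') <= - dotm (gy x' y - r2 *: (y - v)) (t - y').
Proof.
move=> Yt; rewrite -dotmNl; apply: (proj_step _ _ _ _ _ _ sigma0 cY _ Yt).
by rewrite scalerN opprK.
Qed.

(** Strong convexity, used at both x' and the minimizer, bounds (r1 - L) d^2 by the slope of Freg at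
    x'. The projection step controls that slope at x up to dx / tau, and passing from x to x' costs
    (L + r1) dx, at most 2 r1 dx. *)
Lemma step_x_error : frob (x' - xmin y z) <= kappa * dx.
Proof.
move: (xmin_in y z Yy Xz) (xmin_growth y z x' Yy Xz Xx').
move: (xmin y z) => x0 X0; set d := frob (x' - x0) => h1.
have d0 : 0 <= d := frob_ge0 _.
have h2 := fx_smooth y Yy x' x0 Xx' X0; rewrite ler_norml in h2.
case/andP: h2 => h2 _; rewrite (frobBC x0) -/d in h2.
have h3 := frob_sq_shift x' x0 z; rewrite (frobBC x0 x') -/d in h3.
have h4 := step_x_optimality x0 X0.
have h5 : dotm (gx x' y - gx x y) (x' - x0) <= L * dx * d.
  apply: dotm_le_of => //; have := gx_lip x' x y y Xx' Xx Yy Yy.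
  by rewrite subrr frob0 addr0.
have h6 : dotm (x' - x) (x' - x0) <= dx * d by exact: dotm_le.
have h6' : tau^-1 * - dotm (x' - x) (x' - x0) <= tau^-1 * (dx * d).
  by rewrite -dotmNl ler_wpM2l ?(ltW ti0)//; apply: dotm_le_of; rewrite ?frobN.
have h6r : r1 * dotm (x' - x) (x' - x0) <= r1 * (dx * d) by rewrite ler_wpM2l.
have key : (r1 - L) * d ^+ 2 <= (2 * r1 + tau^-1) * dx * d.
  have e1 : dotm (gx x' y) (x0 - x') = - dotm (gx x' y) (x' - x0).
    by rewrite -[x0 - x']opprB dotmNr.
  have e2 : dotm (gx x y + r1 *: (x - z)) (x0 - x') =
      - dotm (gx x y) (x' - x0) - r1 * dotm (x - z) (x' - x0).
    by rewrite -[x0 - x']opprB dotmNr dotmDl dotmZl opprD.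
  have e3 : dotm (x' - z) (x0 - x') =
      - dotm (x - z) (x' - x0) - dotm (x' - x) (x' - x0).
    have -> : x' - z = (x - z) + (x' - x) by rewrite [RHS]addrC addrA subrK.
    by rewrite -[x0 - x']opprB dotmNr dotmDl opprD.
  have e4 : dotm (x - x') (x0 - x') = dotm (x' - x) (x' - x0).
    by rewrite -[x - x']opprB -[x0 - x']opprB dotmNl dotmNr opprK.
  have e5 : dotm (gx x' y - gx x y) (x' - x0) =
      dotm (gx x' y) (x' - x0) - dotm (gx x y) (x' - x0) by rewrite dotmDl dotmNl.
  have hLr : L * (dx * d) <= r1 * (dx * d) by rewrite ler_wpM2r ?mulr_ge0//; move: L0 r1L; lra.
  rewrite e1 in h2; rewrite e2 e4 in h4; rewrite e3 in h3; rewrite e5 in h5.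
  move: h1; rewrite /Freg h3.
  move: h2 h4 h5 h6 h6' h6r hLr; move: (dotm (gx x' y) _) (dotm (gx x y) _).
  move: (dotm (x' - x) _) (dotm (x - z) _) => a b c e; lra.
have : (r1 - L) * d <= (2 * r1 + tau^-1) * dx.
  by apply: le_of_sq_le => //; rewrite mulr_ge0//; move: r10 ti0; lra.
by rewrite -kappaE -mulrA ler_pM2l.
Qed.

(** The projection gains dx^2 / tau, and smoothness loses (L + r1) dx^2 / 2, at most two thirds of
    that gain. *)
Lemma step_x_descent : Freg x' y z + tau^-1 / 3 * dx ^+ 2 <= Freg x y z.
Proof.
have h2 := fx_smooth y Yy x x' Xx Xx'; rewrite ler_norml in h2.
case/andP: h2 => _ h2; rewrite -/dx in h2.
have h3 := frob_sq_shift x x' z; rewrite -/dx in h3.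
have h4 := step_x_optimality x Xx.
have e1 : dotm (x - x') (x - x') = dx ^+ 2 by rewrite -frob_sq frobBC.
have e2 : dotm (gx x y + r1 *: (x - z)) (x - x') =
   - dotm (gx x y) (x' - x) - r1 * dotm (x - z) (x' - x).
  by rewrite -[x - x']opprB dotmNr dotmDl dotmZl opprD.
rewrite e1 e2 in h4.
have h5 : 3 * (L + r1) * dx ^+ 2 <= 4 * tau^-1 * dx ^+ 2 by rewrite ler_wpM2r// sqr_ge0.
rewrite /Freg h3; lra.
Qed.

(** The ascent step raises F by about gy.(y' - y) but lowers -2 G by twice as much, because x' is
    close to the minimizer: the weight 2 turns ascent into descent. The v-term has the sign that
    completes gy to the gradient actually used in the step. Replacing the minimizer by x' creates
    the cross term in dx dy. *)
Lemma step_y_ascent :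
  (Freg x' y' z - 2 * Freg (xmin y' z) y' z + r2 / 2 * w ^+ 2) +
     (2 / 3 * sigma^-1 * dy ^+ 2 - 2 * l * kappa * dx * dy) <=
  Freg x' y z - 2 * Freg (xmin y z) y z + r2 / 2 * frob (y - v) ^+ 2.
Proof.
move: (xmin_in y' z Yy' Xz) (xmin_lipschitz_y _ _ z Yy Yy' Xz) step_x_error
  (xminP y z Yy Xz).2.
move: (xmin y' z) (xmin y z) => x1 x0 X1 hlip err /(_ x1 X1) h1.
have h2 := fy_smooth x1 X1 y y' Yy Yy'; rewrite ler_norml -/dy in h2.
case/andP: h2 => h2 _.
have h3 := fy_smooth x' Xx' y y' Yy Yy'; rewrite ler_norml -/dy in h3.
case/andP: h3 => _ h3.
have h4 := frob_sq_shift y y' v; rewrite -/dy -/w in h4.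
have h5 := step_y_optimality y Yy.
have e1 : dotm (y - y') (y - y') = dy ^+ 2 by rewrite -frob_sq frobBC.
have e2 : dotm (gy x' y - r2 *: (y - v)) (y - y') =
   - dotm (gy x' y) (y' - y) + r2 * dotm (y - v) (y' - y).
  by rewrite -[y - y']opprB dotmNr dotmDl dotmNl dotmZl opprD opprK.
rewrite e1 e2 in h5.
have dist : frob (x' - x1) <= kappa * dx + dy.
  apply: le_trans (frob_triangle _ x0 _) _; rewrite lerD//.
  by rewrite (frobBC _ x1).
have h6 : dotm (gy x' y - gy x1 y) (y' - y) <= l * (kappa * dx + dy) * dy.
  apply: dotm_le_of => //; apply: le_trans (gy_lip x' x1 y y Xx' X1 Yy Yy) _.
  by rewrite subrr frob0 addr0 ler_wpM2l// ltW.
rewrite dotmDl dotmNl in h6.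
have h7 : (12 * l + 6 * r2) * dy ^+ 2 <= sigma^-1 * dy ^+ 2 by rewrite ler_wpM2r// sqr_ge0.
have h8 : 0 <= l * dy ^+ 2 by rewrite mulr_ge0 ?sqr_ge0// ltW.
have h9 : 0 <= r2 * dy ^+ 2 by rewrite mulr_ge0 ?sqr_ge0// ltW.
rewrite h4; move: h1; rewrite /Freg; lra.
Qed.

(* The cross term is absorbed since (l kappa)^2 <= 1 / (9 tau sigma). *)
Lemma cross_term_absorbed :
  2 * l * kappa * dx * dy <= tau^-1 / 4 * dx ^+ 2 + 4 / 9 * sigma^-1 * dy ^+ 2.
Proof.
have lk : 9 * (l * kappa) ^+ 2 <= tau^-1 * sigma^-1.
  have h1 : l * (3 * l * kappa ^+ 2) <= l * (2 * sigma^-1) by rewrite ler_wpM2l// ltW.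
  have h2 : 6 * l * sigma^-1 <= tau^-1 * sigma^-1 by rewrite ler_wpM2r// ltW.
  by lra.
have h : 0 <= (tau^-1 / 2 * dx - 2 * (l * kappa) * dy) ^+ 2 := sqr_ge0 _.
have h' : 9 * (l * kappa) ^+ 2 * dy ^+ 2 <= tau^-1 * sigma^-1 * dy ^+ 2.
  by rewrite ler_wpM2r// sqr_ge0.
rewrite -subr_ge0 -(pmulr_rge0 _ ti0).
by move: h h'; lra.
Qed.

Lemma step_v_descent :
  r2 / 2 * frob (y' - v') ^+ 2 + r2 * mu / 2 * w ^+ 2 <= r2 / 2 * w ^+ 2.
Proof.
have -> : y' - v' = (1 - mu) *: (y' - v).
  by rewrite stepv opprD addrA scalerBl scale1r.
have [mu0 mu1] := andP mu01.
rewrite frobZ ?subr_ge0 ?(ltW mu1)// -/w.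
have : 0 <= r2 * mu * (1 - mu) * w ^+ 2.
  by rewrite !mulr_ge0 ?sqr_ge0 ?subr_ge0// ltW.
lra.
Qed.

Let e := frob (xprox z - xmin y' z).

(** Testing the old proximal point at z' and the new minimizer at z bounds the change of 2 M - 2 G
    by 2 r1 times the inner product of their difference with z - z'. That difference is at most e +
    2 beta u, while F itself gains about r1 beta u^2. *)
Lemma step_z_descent :
  (Freg x' y' z' - 2 * Freg (xmin y' z') y' z' + 2 * fmreg (xprox z') z') +
    (r1 * beta / 5 * u ^+ 2 - 2 * r1 * beta * e ^+ 2) <=
  Freg x' y' z - 2 * Freg (xmin y' z) y' z + 2 * fmreg (xprox z) z.
Proof.
have Xa := xmin_in y' z' Yy' Xz'; have Xb := xprox_in z Xz.
have h1 := (xminP y' z Yy' Xz).2 _ Xa; have h2 := (xproxP z' Xz').2 _ Xb.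
have hlip := xmin_lipschitz_z y' z z' Yy' Xz Xz'.
rewrite /e /Freg /fmreg; move: hlip Xa Xb h1 h2; rewrite /Freg /fmreg /=.
move: (xmin y' z') (xprox z) (xmin y' z) (xprox z') => a b a' b' hlip Xa Xb h1 h2.
set d := frob (b - a').
have [b0 b15] := andP beta01.
have dz : frob (z' - z) = beta * u.
  by rewrite stepz addrAC subrr add0r frobZ// ltW.
have h3 : dotm (b - a) (z - z') <= beta * u * (d + 2 * (beta * u)).
  rewrite dotmC; apply: dotm_le_of; first by rewrite frobBC dz.
  apply: le_trans (frob_triangle _ a' _) _; rewrite lerD//.
  by rewrite frobBC -dz.
have ea := frob_sq_recenter a z z'; have eb := frob_sq_recenter b z z'.
have ex : frob (x' - z') = (1 - beta) * u.
  have -> : x' - z' = (1 - beta) *: (x' - z).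
    by rewrite stepz opprD addrA scalerBl scale1r.
  by rewrite frobZ//; lra.
rewrite dotmDl dotmNl -[z - z']opprB !dotmNr in h3.
have h3' := ler_wpM2l r10 h3.
have h4 : 2 * u * d <= u ^+ 2 / 2 + 2 * d ^+ 2.
  by have := sqr_ge0 (u - 2 * d); lra.
have rb : 0 <= r1 * beta by rewrite mulr_ge0// ltW.
have h4' := ler_wpM2l rb h4.
(* Of the gain u^2, one half pays for the product 2 u d, and the terms 9/2 beta u^2 take at most
   3/10 when beta <= 1/15; 1/5 remains. *)
have h5 : r1 * beta * u ^+ 2 * beta <= r1 * beta * u ^+ 2 * (1 / 15).
  by rewrite ler_wpM2l// mulr_ge0// sqr_ge0.
move: h1 h2; rewrite ea eb ex -/u; lra.
Qed.

Definition lyapunov a b c d :=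
  Freg a b c - 2 * Freg (xmin b c) b c + 2 * fmreg (xprox c) c
    + r2 / 2 * frob (b - d) ^+ 2.

(** Absorbing the cross term leaves 1/3 - 1/4 = 1/12 for dx and 2/3 - 4/9 = 2/9 for dy. *)
Lemma lyapunov_descent :
  lyapunov x' y' z' v' + (tau^-1 / 12 * dx ^+ 2 + 2 / 9 * sigma^-1 * dy ^+ 2
     + r2 * mu / 2 * w ^+ 2 + r1 * beta / 5 * u ^+ 2)
  <= lyapunov x y z v + 2 * r1 * beta * e ^+ 2.
Proof.
move: step_x_descent step_y_ascent cross_term_absorbed step_v_descent step_z_descent.
rewrite /lyapunov.
move: (Freg x' y z) (Freg x y z) (Freg x' y' z) (Freg x' y' z').
move: (Freg (xmin y' z) y' z) (Freg (xmin y' z') y' z') (Freg (xmin y z) y z).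
move: (fmreg (xprox z) z) (fmreg (xprox z') z') (frob (y - v)) (frob (y' - v')).
by move=> *; lra.
Qed.

(** Approximate stationarity in y at any policy t: it is needed at x' for the final gap and at the
    minimizer for [prox_error]. *)
Lemma step_y_gap t b : X t -> Y b ->
  dotm (gy t y') (b - y') <=
    dY * (l * (frob (t - x') + dy) + r2 * (w + dy) + sigma^-1 * dy).
Proof.
move=> Xt Yb; have h1 := step_y_optimality b Yb.
set A := b - y' in h1 *; have hA : frob A <= dY := diamY _ _ Yb Yy'.
have h2 : dotm (gy t y' - gy x' y) A <= l * (frob (t - x') + dy) * dY.
  by apply: dotm_le_of => //; exact: gy_lip.
have h3 : dotm (y - v) A <= (w + dy) * dY.
  apply: dotm_le_of => //; apply: le_trans (frob_triangle _ y' _) _.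
  by rewrite addrC lerD// frobBC.
have h4 : - dotm (y - y') A <= dy * dY.
  by rewrite -dotmNl; apply: dotm_le_of; rewrite ?frobN// frobBC.
have h3' : r2 * dotm (y - v) A <= r2 * ((w + dy) * dY) by rewrite ler_wpM2l// ltW.
have h4' : sigma^-1 * - dotm (y - y') A <= sigma^-1 * (dy * dY).
  by rewrite ler_wpM2l// ltW.
rewrite dotmDl dotmNl in h2; rewrite [dotm (gy x' y - _) A]dotmDl dotmNl dotmZl in h1.
move: h1 h2 h3' h4'; lra.
Qed.

Lemma step_x_gap t : X t ->
  dotm (gx x' y') (x' - t) <= dX * (tau^-1 * dx + L * (dx + dy) + r1 * (dx + u)).
Proof.
move=> Xt; have h1 := step_x_optimality t Xt.
rewrite -[t - x']opprB !dotmNr in h1.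
set A := x' - t in h1 *; have hA : frob A <= dX := diamX _ _ Xx' Xt.
have h2 : dotm (gx x' y' - gx x y) A <= L * (dx + dy) * dX.
  by apply: dotm_le_of => //; exact: gx_lip.
have h3 : - dotm (x - z) A <= (dx + u) * dX.
  rewrite -dotmNl; apply: dotm_le_of => //; rewrite frobN.
  apply: le_trans (frob_triangle _ x' _) _.
  by rewrite lerD// frobBC.
have h4 : dotm (x - x') A <= dx * dX by apply: dotm_le_of => //; rewrite frobBC.
have h3' : r1 * - dotm (x - z) A <= r1 * ((dx + u) * dX) by rewrite ler_wpM2l.
have h4' : tau^-1 * dotm (x - x') A <= tau^-1 * (dx * dX) by rewrite ler_wpM2l// ltW.
rewrite dotmDl dotmNl in h2; rewrite [dotm (gx x y + _) A]dotmDl dotmZl in h1.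
move: h1 h2 h3' h4'; lra.
Qed.

(** Growth of [fmreg] at its minimizer bounds e^2 by the excess at a = xmin y' z. Since [fmreg]
    dominates [Freg] at y' and a minimizes the latter, this excess is at most fm a - f a y', to
    which dominance in y applies. *)
Lemma prox_error : e ^+ 2 <= prox_const * (dx + dy + w).
Proof.
have Xb := xprox_in z Xz; have Xa := xmin_in y' z Yy' Xz.
have h1 := min_quad_growth _ _ _ _ _ cX (fmreg_strongly_convex z) (xproxP z Xz) Xa.
have h2 := (xminP y' z Yy' Xz).2 _ Xb; have h3 := f_le_fm _ _ Xb Yy'.
have dist : frob (xmin y' z - x') <= kappa * dx + dy.
  rewrite frobBC; apply: le_trans (frob_triangle _ (xmin y z) _) _.
  by rewrite lerD ?step_x_error// frobBC; exact: xmin_lipschitz_y.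
have [b Yb hb] := dominance_y _ _ Xa Yy'; have h4 := step_y_gap _ _ Xa Yb.
rewrite frobBC -/e in h1; rewrite /e in h1 *.
move: h1 h2 h3 h4 hb dist; rewrite /Freg /fmreg /=.
move: (xmin y' z) (xprox z) => a c.
set d := frob (c - a) => h1 h2 h3 h4 hb dist.
have gap : (r1 - L) / 2 * d ^+ 2 <= Cy * (dY * ((l * kappa + 2 * l + r2 + sigma^-1) *
    (dx + dy + w))).
  apply: le_trans (_ : Cy * dotm (gy a y') (b - y') <= _); first by lra.
  rewrite ler_wpM2l//; apply: le_trans h4 _; rewrite ler_wpM2l//.
  have hl : l * (frob (a - x') + dy) <= l * (kappa * dx + 2 * dy).
    by rewrite ler_wpM2l ?(ltW l0)//; lra.
  have k1 : 0 <= l * kappa * (dy + w) by rewrite !mulr_ge0 ?addr_ge0// ltW.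
  have k2 : 0 <= l * (dx + w) by rewrite !mulr_ge0 ?addr_ge0// ltW.
  have k3 : 0 <= r2 * dx by rewrite mulr_ge0// ltW.
  have k4 : 0 <= sigma^-1 * (dx + w) by rewrite mulr_ge0 ?addr_ge0// ltW.
  by lra.
have -> : d ^+ 2 = 2 / (r1 - L) * ((r1 - L) / 2 * d ^+ 2) by field; rewrite gt_eqF.
rewrite /prox_const -[leRHS]mulrA ler_wpM2l ?divr_ge0 ?(ltW m0)//.
by apply: le_trans gap _; rewrite !mulrA.
Qed.

(** Split through fm x' and f x' y': the Lipschitz bound of fm handles the first difference,
    dominance in y the second, dominance in x the third. *)
Lemma step_gap t : X t -> fm z' - fm t <= gap_const * (dx + dy + w + u).
Proof.
move=> Xt; have [b0 b15] := andP beta01.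
have h1 : fm z' - fm x' <= lip * u.
  apply: le_trans (fm_lip _ _ Xx' Xz') _; rewrite ler_wpM2l//.
  have -> : z' - x' = (1 - beta) *: (z - x').
    by rewrite stepz scalerBl scale1r -[x' - z]opprB scalerN addrAC.
  rewrite frobZ; last by lra.
  by rewrite frobBC -/u ler_piMl//; lra.
have [b Yb hb] := dominance_y _ _ Xx' Yy'.
have [s Xs hs] := dominance_x _ _ _ Xx' Yy' Xt.
have h2 := ler_wpM2l Cy0 (step_y_gap _ _ Xx' Yb).
have h3 := ler_wpM2l Cx0 (step_x_gap _ Xs).
rewrite subrr frob0 add0r in h2.
have p1 : 0 <= lip * (dx + dy + w) by rewrite mulr_ge0// !addr_ge0.
have p2 : 0 <= Cy * (dY * (l * (dx + w + u))) by rewrite !mulr_ge0 ?addr_ge0// ltW.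
have p3 : 0 <= Cy * (dY * (r2 * (dx + u))) by rewrite !mulr_ge0 ?addr_ge0// ltW.
have p4 : 0 <= Cy * (dY * (sigma^-1 * (dx + w + u))).
  by rewrite !mulr_ge0 ?addr_ge0// ltW.
have p5 : 0 <= Cx * (dX * (tau^-1 * (dy + w + u))).
  by rewrite !mulr_ge0 ?addr_ge0// ltW.
have p6 : 0 <= Cx * (dX * (L * (w + u))) by rewrite !mulr_ge0 ?addr_ge0// ltW.
have p7 : 0 <= Cx * (dX * (r1 * (dy + w))) by rewrite !mulr_ge0 ?addr_ge0.
rewrite /gap_const.
move: h1 h2 h3 hb hs p1 p2 p3 p4 p5 p6 p7; lra.
Qed.

Lemma lyapunov_descent_residual a : 0 < a -> a <= tau^-1 / 12 ->
  a <= 2 / 9 * sigma^-1 -> a <= r2 * mu / 2 ->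
  lyapunov x' y' z' v' + (a / 6 * (dx + dy + w) ^+ 2 + r1 * beta / 5 * u ^+ 2)
  <= lyapunov x y z v + 6 * r1 ^+ 2 * prox_const ^+ 2 / a * beta ^+ 2.
Proof.
move=> a0 a1 a2 a3; have [b0 b15] := andP beta01.
have h1 := lyapunov_descent.
have h2 : 2 * r1 * beta * e ^+ 2 <= 2 * r1 * beta * (prox_const * (dx + dy + w)).
  by rewrite ler_wpM2l ?prox_error// !mulr_ge0// ltW.
have ha := ler_wpM2r (sqr_ge0 dx) a1; have hb := ler_wpM2r (sqr_ge0 dy) a2.
have hc := ler_wpM2r (sqr_ge0 w) a3.
have cs : a * (dx + dy + w) ^+ 2 <= 3 * (a * dx ^+ 2 + a * dy ^+ 2 + a * w ^+ 2).
  have := mulr_ge0 (ltW a0) (sqr_ge0 (dx - dy)).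
  have := mulr_ge0 (ltW a0) (sqr_ge0 (dx - w)).
  by have := mulr_ge0 (ltW a0) (sqr_ge0 (dy - w)); lra.
(* By [cs] the residual terms are worth a / 3 times the squared sum. Half of this pays for the
   linear error by Young's inequality, the other half is kept. *)
have amgm : 2 * r1 * beta * (prox_const * (dx + dy + w)) <=
    a / 6 * (dx + dy + w) ^+ 2 + 6 * r1 ^+ 2 * prox_const ^+ 2 / a * beta ^+ 2.
  rewrite -subr_ge0.
  have -> : a / 6 * (dx + dy + w) ^+ 2 + 6 * r1 ^+ 2 * prox_const ^+ 2 / a * beta ^+ 2
      - 2 * r1 * beta * (prox_const * (dx + dy + w)) =
      (6 * a)^-1 * (a * (dx + dy + w) - 6 * r1 * beta * prox_const) ^+ 2.
    by field; rewrite gt_eqF.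
  by rewrite mulr_ge0 ?sqr_ge0// invr_ge0 mulr_ge0// ltW.
move: h1 h2 ha hb hc cs amgm.
move: (lyapunov x' y' z' v') (lyapunov x y z v) => l1 l2.
move: (prox_const * _) (6 * r1 ^+ 2 * prox_const ^+ 2 / a * beta ^+ 2) => c1 c2.
lra.
Qed.

End OneStep.

(** * Summation along a run *)

Section Run.
Context (x z : nat -> MX) (y v : nat -> MY) (beta : R) (K : nat).
Hypotheses (Xx0 : X (x 0%N)) (Yy0 : Y (y 0%N)) (z0 : z 0%N = x 0%N) (v0 : v 0%N = y 0%N).
Hypothesis beta01 : 0 < beta <= 1 / 15.
Hypothesis run : forall k, (k < K)%N ->
  [/\ is_proj X (x k - tau *: (gx (x k) (y k) + r1 *: (x k - z k))) (x k.+1),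
      is_proj Y (y k + sigma *: (gy (x k.+1) (y k) - r2 *: (y k - v k))) (y k.+1),
      z k.+1 = z k + beta *: (x k.+1 - z k) &
      v k.+1 = v k + mu *: (y k.+1 - v k)].

Let res k := frob (x k.+1 - x k) + frob (y k.+1 - y k) + frob (y k.+1 - v k).
Let u k := frob (x k.+1 - z k).

Lemma run_in k : (k <= K)%N -> [/\ X (x k), Y (y k) & X (z k)].
Proof.
elim: k => [_|k IH kK]; first by rewrite z0.
have [Xx Yy Xz] := IH (ltnW kK); have [[Xx' _] [Yy' _] -> _] := run k kK.
split => //; apply: cX => //; case/andP: beta01 => b0 b1; rewrite ltW//=; lra.
Qed.

(** Group it as (F - G) + (M - G) + M plus a square; G is below both F and M, and M >= 0 because f
    is. *)
Lemma lyapunov_ge0 k : (k <= K)%N -> 0 <= lyapunov (x k) (y k) (z k) (v k).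
Proof.
move=> kK; have [Xx Yy Xz] := run_in k kK.
have h1 := (xminP _ _ Yy Xz).2 _ Xx.
have h2 := (xminP _ _ Yy Xz).2 _ (xprox_in _ Xz).
have h3 := f_le_fm _ _ (xprox_in _ Xz) Yy.
have /andP[h4 _] := f_bound _ _ (xprox_in _ Xz) Yy.
have h5 : 0 <= r1 / 2 * frob (xprox (z k) - z k) ^+ 2 by rewrite mulr_ge0 ?sqr_ge0 ?divr_ge0.
have h6 : 0 <= r2 / 2 * frob (y k - v k) ^+ 2.
  by rewrite mulr_ge0 ?sqr_ge0 ?divr_ge0 ?(ltW r20).
move: h1 h2; rewrite /lyapunov /fmreg /=.
move: (Freg (xmin (y k) (z k)) _ _) => G h1; rewrite {1}/Freg => h2.
by move: h1 h2 h3 h4 h5 h6; lra.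
Qed.

(** The centers start at the iterates, so the regularizers vanish at the start: F <= B, G >= 0, and
    M is at most fm at its center. The bound is therefore free of the initial point. *)
Lemma lyapunov_start : lyapunov (x 0%N) (y 0%N) (z 0%N) (v 0%N) <= 3 * B.
Proof.
have [Xx Yy Xz] := run_in 0 (leq0n K).
have /andP[_ h1] := f_bound _ _ Xx Yy.
have h2 := (xproxP _ Xz).2 _ Xz.
have [b Yb fmE] := fm_attained _ Xz; have /andP[_ h3] := f_bound _ _ Xz Yb.
have /andP[h4 _] := f_bound _ _ (xmin_in _ _ Yy Xz) Yy.
have h5 : 0 <= r1 / 2 * frob (xmin (y 0%N) (z 0%N) - z 0%N) ^+ 2.
  by rewrite mulr_ge0 ?sqr_ge0 ?divr_ge0.
move: h2; rewrite {2}/fmreg fmE subrr frob0 /lyapunov.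
move: (fmreg (xprox _) _) => M h2; rewrite /Freg [in y 0%N - v 0%N]v0 subrr frob0.
by rewrite [in x 0%N - z 0%N]z0 subrr frob0; lra.
Qed.

Lemma run_gap a : 0 < a -> a <= tau^-1 / 12 -> a <= 2 / 9 * sigma^-1 ->
  a <= r2 * mu / 2 -> (2 <= K)%N ->
  exists2 k, (0 < k < K)%N &
    (forall t, X t -> fm (z k.+1) - fm t <= gap_const * (res k + u k)) /\
    K%:R * (a / 6 * res k ^+ 2 + r1 * beta / 5 * u k ^+ 2) <=
      2 * (3 * B + K%:R * (6 * r1 ^+ 2 * prox_const ^+ 2 / a * beta ^+ 2)).
Proof.
move=> a0 a1 a2 a3 K2.
set E := 6 * r1 ^+ 2 * prox_const ^+ 2 / a * beta ^+ 2.
pose T k := a / 6 * res k ^+ 2 + r1 * beta / 5 * u k ^+ 2.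
have T0 k : 0 <= T k.
  have [b0 _] := andP beta01.
  by rewrite addr_ge0// mulr_ge0 ?sqr_ge0// ?divr_ge0 ?mulr_ge0// ltW.
have decr k : (k < K)%N ->
    lyapunov (x k.+1) (y k.+1) (z k.+1) (v k.+1) + T k <= lyapunov (x k) (y k) (z k) (v k) + E.
  move=> kK; have [Xx Yy Xz] := run_in k (ltnW kK); have [sx sy sz sv] := run k kK.
  exact: lyapunov_descent_residual Xx Xz Yy beta01 sx sy sz sv a a0 a1 a2 a3.
have sumT k : (k <= K)%N -> \sum_(i < k) T i + lyapunov (x k) (y k) (z k) (v k) <=
    lyapunov (x 0%N) (y 0%N) (z 0%N) (v 0%N) + k%:R * E.
  elim: k => [_|k IH kK]; first by rewrite big_ord0 mul0r addr0 add0r.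
  have := decr k kK; have := IH (ltnW kK); rewrite big_ord_recr/= -natr1; lra.
have total : \sum_(i < K) T i <= 3 * B + K%:R * E.
  have := sumT K (leqnn K); have := lyapunov_ge0 K (leqnn K).
  by have := lyapunov_start; lra.
have [k kK hk] := exists_le_average T K _ K2 T0 total.
exists k => //; split => // t Xt.
have /andP[_ kK'] := kK.
have [Xx Yy Xz] := run_in k (ltnW kK'); have [sx sy sz sv] := run k kK'.
exact: step_gap Xx Xz Yy beta01 sx sy sz t Xt.
Qed.

End Run.
End Descent.

(** * Gradients of regularized objectives *)

Lemma is_derive_frob_sq {R : realType} {m n} (x z d : 'M[R]_(m, n)) :
  is_derive x d (fun w => frob (w - z) ^+ 2) (2 * dotm (x - z) d).
Proof.
apply: (is_derive_quotient _ _ _ (fun h => 2 * dotm (x - z) d + h * dotm d d)).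
  near=> h; rewrite (frob_sq_shift x (x + h *: d) z).
  have -> : x + h *: d - x = h *: d by rewrite addrAC subrr add0r.
  by rewrite (frob_sq (h *: d)) !dotmE; ring.
apply: (cvg_of_lipschitz _ _ `|dotm d d|); near=> h.
by rewrite [_ + _ * _ - _]addrAC subrr add0r normrM mulrC.
Unshelve. all: by end_near. Qed.

(** Covers both partial gradients of [chi]: a is r1 or - r2, and k collects the regularizer that is
    frozen in the current half-step. *)
Lemma grad_add_quadratic {R : realType} {m n} (F G : 'M[R]_(m, n) -> R)
    (x z : 'M[R]_(m, n)) (a k : R) :
  (forall d, is_derive x d F (dotm (grad F x) d)) ->
  (forall w, G w = F w + a / 2 * frob (w - z) ^+ 2 + k) ->
  grad G x = grad F x + a *: (x - z).
Proof.
move=> dF GE; apply/matrixP => i j.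
set d : 'M[R]_(m, n) := delta_mx i j.
have dG : is_derive x d G (dotm (grad F x + a *: (x - z)) d).
  have -> : G = (F + (a / 2) *: (fun w => frob (w - z) ^+ 2)) + cst k.
    by apply/funext => w; rewrite GE.
  have -> : dotm (grad F x + a *: (x - z)) d =
      dotm (grad F x) d + (a / 2) *: (2 * dotm (x - z) d) + 0.
    rewrite [LHS]dotmDl dotmZl addr0; congr (_ + _).
    by move: (dotm (x - z) d) => s; rewrite /GRing.scale/=; field.
  have h1 := @is_deriveZ _ _ _ _ (a / 2) x d _ (is_derive_frob_sq x z d).
  exact: is_deriveD (is_deriveD (dF d) h1) (is_derive_cst _ _ _).
by rewrite -[RHS]dotm_delta -/d mxE (derive_val (is_derive := dG)).
Qed.

(** * The robust Markov decision process *)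

Section Instance.
Context {R : realType} {nS nA : nat} (gamma : R) (rho : 'rV[R]_nS)
  (c : 'I_nS -> 'I_nA -> 'I_nS -> R) (P : set 'M[R]_(nS * nA, nS)) (D : R).
Local Notation Pi := (@policies R nS nA).
Local Notation J := (J gamma rho c).
Local Notation phi := (phi gamma rho c P).
Hypotheses (hg : 0 < gamma < 1) (hrho : simplex rho)
  (hc : forall s a s', 0 <= c s a s' <= 1)
  (hP : ambiguity_set P) (hD : bounded_mismatch gamma rho c P D) (D0 : 0 <= D).
Implicit Types (x z w : 'M[R]_(nS, nA)) (y : 'M[R]_(nS * nA, nS)).

Let sub_kernels : P `<=` @kernels R nS nA. Proof. by case: hP. Qed.
Let g1 : 0 < 1 - gamma. Proof. by case/andP: hg => _; rewrite subr_gt0. Qed.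

Lemma ambiguity_segment : segment_closed P.
Proof.
move=> y y' t Py Py' /andP[t0 t1].
have [_ _ _ cvx _] := hP.
have s0 : 0 <= 1 - t by rewrite subr_ge0.
have s1 : 1 - t <= 1 by rewrite gerBl.
have := cvx y y' (Itv01 s0 s1) (mem_set Py) (mem_set Py'); rewrite inE.
have -> : (y : convex_lmodType 'M[R]_(nS * nA, nS)) <| Itv01 s0 s1 |> y' =
    (1 - t) *: y + (1 - (1 - t)) *: y' by [].
have -> : 1 - (1 - t) = t by rewrite opprB addrC subrK.
by rewrite scalerBl scale1r scalerBr -addrA [- _ + _]addrC.
Qed.

(** Replaces the diameter of P by a bound free of P, so that C can be fixed beforehand. *)
Lemma ambiguity_frob y y' : P y -> P y' -> frob (y - y') <= (nS * nA)%:R * nS%:R.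
Proof.
move=> /sub_kernels hy /sub_kernels hy'; rewrite -[leRHS]mulr1.
apply: frob_le_const => // k s'; case/mxvec_indexP: k => s a.
have entry (q : 'M[R]_(nS * nA, nS)) : kernels q -> 0 <= q (mxvec_index s a) s' <= 1.
  move=> /(_ s a)[h0 h1]; have q0 b : 0 <= q (mxvec_index s a) b.
    by have := h0 b; rewrite !mxE.
  rewrite q0 -[leRHS]h1 (bigD1 s')//= !mxE lerDl sumr_ge0// => b _; by rewrite !mxE.
by have := entry _ hy; have := entry _ hy'; rewrite !mxE ler_norml; lra.
Qed.

(** Dominance needs a maximizing kernel at which the mismatch is also bounded; [bounded_mismatch]
    provides both properties at the same kernel. *)
Lemma phi_attained x : Pi x ->
  exists y, [/\ P y, phi x = J x y, (forall y', P y' -> J x y' <= phi x) &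
    (mismatch gamma rho x y <= D%:E)%E].
Proof.
move=> Xx; have [y [Py hmax mm]] := hD.1 x Xx.
have ub : ubound [set J x q | q in P] (J x y) by move=> _ [q Pq <-]; exact: hmax.
have e : phi x = J x y.
  apply/eqP; rewrite eq_le; apply/andP; split.
    by apply: ge_sup => //; exists (J x y); exists y.
  by apply: ub_le_sup; [exists (J x y) | exists y].
by exists y; split => // y' Py'; rewrite e; exact: hmax.
Qed.

Lemma J_le_phi x y : Pi x -> P y -> J x y <= phi x.
Proof. by move=> Xx Py; have [? [_ _ + _]] := phi_attained x Xx; apply. Qed.

Lemma phi_attained_at x : Pi x -> exists2 y, P y & phi x = J x y.
Proof. by move=> Xx; have [y [Py e _ _]] := phi_attained x Xx; exists y. Qed.

Lemma phi_lipschitz x x' : Pi x -> Pi x' ->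
  phi x' - phi x <= nA%:R / (1 - gamma) ^+ 2 * frob (x' - x).
Proof.
move=> Xx Xx'; have [y Py ->] := phi_attained_at x' Xx'.
have := J_le_phi x y Xx Py.
have := J_policy_lipschitz _ _ _ hg hrho hc x x' y Xx Xx' (sub_kernels _ Py).
by lra.
Qed.

Lemma regularized_min (f : 'M[R]_(nS, nA) -> R) (k r : R) z : 0 <= k -> 0 <= r ->
  Pi z -> (forall x x', Pi x -> Pi x' -> f x' - f x <= k * frob (x' - x)) ->
  exists x, is_min Pi (fun x => f x + r / 2 * frob (x - z) ^+ 2) x.
Proof.
move=> k0 r0 Xz hf; set B := nS%:R * nA%:R : R.
have B0 : 0 <= B by rewrite mulr_ge0.
apply: (policies_min _ (k + r * B)); first by rewrite addr_ge0// mulr_ge0.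
  by exists z.
move=> x x' Xx Xx'; have h1 := hf x x' Xx Xx'.
have h2 := policies_frob x' z Xx' Xz; have h3 := policies_frob x z Xx Xz.
have h4 := frob_triangle x' x z.
rewrite mulrDl.
have d0 := frob_ge0 (x' - x); have d1 := frob_ge0 (x' - z); have d2 := frob_ge0 (x - z).
have h5 : frob (x' - z) ^+ 2 - frob (x - z) ^+ 2 <= 2 * (B * frob (x' - x)).
  move: h2 h3 h4 d0 d1 d2; rewrite -/B.
  move: (frob (x' - z)) (frob (x - z)) (frob (x' - x)) => s t d hs ht hd d0 s0 t0.
  apply: le_trans (_ : (s + t) * (s - t) <= _); first by lra.
  apply: le_trans (_ : (s + t) * d <= _).
    by rewrite ler_wpM2l ?addr_ge0//; lra.
  by rewrite mulrA ler_wpM2r//; lra.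
have h6 := ler_wpM2l r0 h5.
move: h1 h6; lra.
Qed.

Lemma dominance_y_instance x y : Pi x -> P y -> exists2 y', P y' &
  phi x - J x y <=
    D / (1 - gamma) * dotm (grad (fun q => J x q) y) (y' - y).
Proof.
move=> Xx Py; have [y' [Py' -> _ mm]] := phi_attained x Xx.
have [_ _ _ _ srec] := hP.
exact: (dominance_kernel _ _ _ hg hrho P D x y y').
Qed.

(** Dominance is applied against a best response w' to y, where the mismatch is controlled; then J
    w' y <= J w y <= phi w replaces any exchange of min and max. *)
Lemma dominance_x_instance x y w : Pi x -> P y -> Pi w -> exists2 x', Pi x' &
  J x y - phi w <= D / (1 - gamma) * dotm (grad (fun q => J q y) x) (x - x').
Proof.
move=> Xx Py Xw; have [w' [Xw' hw' mm]] := hD.2 y Py.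
have [x' Xx' h] := dominance_policy _ _ c hg hrho D x w' y Xx Xw' (sub_kernels _ Py) mm.
exists x' => //; apply: le_trans h; rewrite lerD2l lerN2.
exact: le_trans (hw' w Xw) (J_le_phi w y Xw Py).
Qed.

Lemma srpg_gap (L l r1 r2 tau sigma kappa mu beta a : R) (K : nat) pi p pib pb :
  0 < L -> 0 < l -> 2 * L <= r1 -> 0 < r2 -> 0 < tau -> 0 < sigma ->
  3 * (L + r1) <= 4 * tau^-1 -> 6 * l <= tau^-1 ->
  (r1 - L) * kappa = 2 * r1 + tau^-1 ->
  3 * l * kappa ^+ 2 <= 2 * sigma^-1 -> 12 * l + 6 * r2 <= sigma^-1 ->
  0 < mu < 1 -> 0 < beta <= 1 / 15 ->
  0 < a -> a <= tau^-1 / 12 -> a <= 2 / 9 * sigma^-1 -> a <= r2 * mu / 2 ->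
  grad_lipschitz gamma rho c P L l ->
  srpg_run gamma rho c P r1 r2 tau sigma beta mu K pi p pib pb -> (2 <= K)%N ->
  let B := (1 - gamma)^-1 in let M := D / (1 - gamma) in
  let dY := (nS * nA)%:R * nS%:R in
  exists2 k, (0 < k < K)%N & exists res u : R,
    [/\ 0 <= res, 0 <= u, Pi (pib k.+1),
      (forall w, Pi w -> phi (pib k.+1) - phi w <=
        gap_const L l r1 r2 tau sigma M M (nS%:R * nA%:R) dY
          (nA%:R / (1 - gamma) ^+ 2) * (res + u)) &
      K%:R * (a / 6 * res ^+ 2 + r1 * beta / 5 * u ^+ 2) <=
      2 * (3 * B + K%:R * (6 * r1 ^+ 2 *
        prox_const L l r1 r2 sigma kappa M dY ^+ 2 / a * beta ^+ 2))].
Proof.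
move=> L0 l0 r1L r20 tau0 sigma0 tL tl kE sk sl mu01 beta01 a0 a1 a2 a3 glip
  [Xx0 Yy0 z0 v0 run] K2 B M dY.
pose gx x y := grad (fun w => J w y) x; pose gy x y := grad (fun q => J x q) y.
have dx y : P y -> forall x d, Pi x -> is_derive x d (J^~ y) (dotm (gx x y) d).
  move=> /sub_kernels hy x d hx; rewrite /gx dotm_grad_pi//.
  exact: is_derive_J_pi.
have dy x : Pi x -> forall y d, P y -> is_derive y d (J x) (dotm (gy x y) d).
  move=> hx y d /sub_kernels hy; rewrite /gy dotm_grad_p//.
  exact: is_derive_J_p.
have cX := @policies_segment R nS nA; have cY := ambiguity_segment.
have r10 : 0 <= r1 by lra.
have M0 : 0 <= M by rewrite divr_ge0// ltW.
have dX0 : 0 <= nS%:R * nA%:R :> R by rewrite mulr_ge0.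
have dY0 : 0 <= dY by rewrite mulr_ge0.
have lip0 : 0 <= nA%:R / (1 - gamma) ^+ 2 by rewrite divr_ge0// exprn_ge0// ltW.
have fx_smooth y : P y -> smooth_on Pi (J^~ y) (gx^~ y) L.
  move=> Py; apply: smooth_on_of_lipschitz => //; first exact: dx.
  move=> x x' Xx Xx'; have [+ _] := glip x x' y y Xx Xx' Py Py.
  by rewrite (subrr y) frob0 addr0.
have fy_smooth x : Pi x -> smooth_on P (J x) (gy x) l.
  move=> Xx; apply: smooth_on_of_lipschitz => //; first exact: dy.
  move=> y y' Py Py'; have [_ +] := glip x x y y' Xx Xx Py Py'.
  by rewrite (subrr x) frob0 add0r.
have gx_lip x x' y y' : Pi x -> Pi x' -> P y -> P y' ->
    frob (gx x y - gx x' y') <= L * (frob (x - x') + frob (y - y')).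
  by move=> Xx Xx' Py Py'; case: (glip x x' y y').
have gy_lip x x' y y' : Pi x -> Pi x' -> P y -> P y' ->
    frob (gy x y - gy x' y') <= l * (frob (x - x') + frob (y - y')).
  by move=> Xx Xx' Py Py'; case: (glip x x' y y').
have cross x x' y y' : Pi x -> Pi x' -> P y -> P y' ->
    (J x' y - J x' y') - (J x y - J x y') <= L * frob (y - y') * frob (x' - x).
  move=> Xx Xx' Py Py'.
  apply: (increment_difference_le _ cX _ _ _ _ _ _ _ Xx Xx' (dx y Py) (dx y' Py')).
  move=> t Xt; apply: le_trans (gx_lip _ _ _ _ Xt Xt Py Py') _.
  by rewrite (subrr t) frob0 add0r.
have xmin_ex y z : P y -> Pi z -> exists x, is_min Pi (fun x => Freg J r1 x y z) x.
  move=> Py Xz; apply: (regularized_min _ (nA%:R / (1 - gamma) ^+ 2)) => // x x' Xx Xx'.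
  exact: J_policy_lipschitz hg hrho hc _ _ _ Xx Xx' (sub_kernels _ Py).
have xprox_ex z : Pi z -> exists x, is_min Pi (fun x => fmreg phi r1 x z) x.
  move=> Xz; apply: (regularized_min _ (nA%:R / (1 - gamma) ^+ 2)) => // x x' Xx Xx'.
  exact: phi_lipschitz.
have f_bound x y : Pi x -> P y -> 0 <= J x y <= B.
  by move=> Xx /sub_kernels Py; exact: J_bound.
(* The gradient formulas hold at feasible points, so the rewriting of the gradients of [chi] comes
   together with the feasibility of the iterates, proved by induction. *)
have steps k : (k < K)%N ->
  [/\ is_proj Pi (pi k - tau *: (gx (pi k) (p k) + r1 *: (pi k - pib k))) (pi k.+1),
      is_proj P (p k + sigma *: (gy (pi k.+1) (p k) - r2 *: (p k - pb k))) (p k.+1),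
      pib k.+1 = pib k + beta *: (pi k.+1 - pib k) &
      pb k.+1 = pb k + mu *: (p k.+1 - pb k)] /\
  [/\ Pi (pi k), P (p k) & Pi (pib k)].
  move=> kK; suff inX : [/\ Pi (pi k), P (p k) & Pi (pib k)].
    split => //; have [Xx Yy Xz] := inX; have [sx sy sz sv] := run k kK.
    have Xx' : Pi (pi k.+1) by case: sx.
    split => //.
      have <- : grad (fun w => chi gamma rho c r1 r2 w (p k) (pib k) (pb k)) (pi k) =
          gx (pi k) (p k) + r1 *: (pi k - pib k).
        apply: (@grad_add_quadratic _ _ _ (J^~ (p k)) _ _ _ _
          (- (r2 / 2 * frob (p k - pb k) ^+ 2))) => // d.
        exact: dx.
      exact: sx.
    have <- : grad (fun q => chi gamma rho c r1 r2 (pi k.+1) q (pib k) (pb k)) (p k) =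
        gy (pi k.+1) (p k) - r2 *: (p k - pb k).
      rewrite -scaleNr; apply: (@grad_add_quadratic _ _ _ (J (pi k.+1)) _ _ _ _
        (r1 / 2 * frob (pi k.+1 - pib k) ^+ 2)) => [d|q]; first exact: dy.
      by rewrite /chi; move: (frob _ ^+ 2) (frob _ ^+ 2) (J _ q) => s t w; ring.
    exact: sy.
  elim: k kK => [|k IH] kK; first by rewrite z0.
  have [Xx Yy Xz] := IH (ltnW kK); have [[Xx' _] [Yy' _] -> _] := run k (ltnW kK).
  by split => //; apply: cX => //; case/andP: beta01 => b0 b1; rewrite ltW//=; lra.
have [k kK [hgap hsum]] := run_gap Pi P J gx gy phi L l r1 r2 tau sigma kappa mu
  cX cY L0 l0 r1L r20 tau0 sigma0 tL tl kE sk sl mu01 fx_smooth fy_smooth gx_lip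
  gy_lip cross J_le_phi phi_attained_at xmin_ex xprox_ex B M M (nS%:R * nA%:R) dY
  (nA%:R / (1 - gamma) ^+ 2) f_bound M0 M0 dX0 dY0 lip0 policies_frob
  ambiguity_frob phi_lipschitz dominance_y_instance dominance_x_instance
  pi pib p pb beta K Xx0 Yy0 z0 v0 beta01 (fun k kK => (steps k kK).1)
  a a0 a1 a2 a3 K2.
exists k => //; eexists; eexists; split; [| | | exact: hgap | exact: hsum].
- by rewrite !addr_ge0 ?frob_ge0.
- exact: frob_ge0.
- have /andP[_ kK'] := kK; have [_ [_ _ Xz]] := steps k kK'.
  have [[Xx' _] _ -> _] := run k kK'; apply: cX => //; case/andP: beta01 => b0 b1.
  by rewrite ltW//=; lra.
Qed.

End Instance.

(** * The rate and the role of the diameters *)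

Lemma policies_subsingleton {R : realType} {nS nA : nat} (x y : 'M[R]_(nS, nA)) :
  (nA <= 1)%N -> policies x -> policies y -> x = y.
Proof.
move=> nA1 hx hy; apply/matrixP => s a.
have one (z : 'M[R]_(nS, nA)) : policies z -> z s a = 1.
  move=> /(_ s)[_ <-]; rewrite (bigD1 a)//= mxE big1 ?addr0// => b /negP[].
  apply/eqP/ord_inj; have := leq_trans (ltn_ord a) nA1; have := leq_trans (ltn_ord b) nA1.
  by rewrite !ltnS !leqn0 => /eqP -> /eqP ->.
by rewrite !one.
Qed.

Lemma diam_policies_ge1 {R : realType} {nS nA : nat} (s : 'I_nS) :
  (1 < nA)%N -> 1 <= diam (@policies R nS nA).
Proof.
move=> nA2; pose a : 'I_nA := Ordinal (ltnW nA2); pose b : 'I_nA := Ordinal nA2.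
pose det (i : 'I_nA) : 'M[R]_(nS, nA) := \matrix_(_, j) (j == i)%:R.
have hdet i : policies (det i).
  move=> t; split => [j|]; first by rewrite !mxE.
  by rewrite (bigD1 i)//= !mxE eqxx big1 ?addr0// => j ji; rewrite !mxE (negbTE ji).
apply: le_trans (_ : frob (det a - det b) <= _).
  apply: le_trans (entry_le_frob _ s a); rewrite !mxE eqxx.
  by rewrite (_ : (a == b) = false)// subr0 normr1.
apply: ub_le_sup; last by exists (det a) => //; exists (det b).
by exists (nS%:R * nA%:R) => _ [x hx [y hy <-]]; exact: policies_frob.
Qed.

Lemma fourth_root_pow4 {R : realType} (K : nat) :
  (K%:R `^ (4^-1 : R)) ^+ 4 = K%:R.
Proof.
by rewrite -powR_mulrn ?powR_ge0// -powRrM mulVf ?powRr1.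
Qed.

Lemma fourth_root_invsqrt {R : realType} (K : nat) :
  K%:R `^ (- 2^-1 : R) = ((K%:R `^ (4^-1 : R)) ^+ 2)^-1.
Proof.
rewrite powRN -powR_mulrn ?powR_ge0// -powRrM; congr (_ `^ _)^-1.
by field.
Qed.

(** A crude substitute for a square root that keeps the final constant rational in the data. *)
Lemma le_of_sq_le_add1 {R : realType} (t A : R) : 0 <= t -> t ^+ 2 <= A -> t <= 1 + A.
Proof.
by move=> t0 h; have := sqr_ge0 (t - 1); have := sqr_ge0 t; nra.
Qed.

(* With s = K^(1/4) and beta of order s^-2, the averaged descent inequality
   bounds both s * res and s * u independently of K. *)
Lemma rate_of_average {R : realType} (a r1 beta c1 c2 B E T s res u : R) :
  0 < a -> 0 < r1 -> 0 < c1 -> 0 <= E -> 0 <= B -> 1 <= s -> 0 <= res -> 0 <= u ->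
  0 < beta -> c1 * (s ^+ 2)^-1 <= beta -> beta <= c2 * (s ^+ 2)^-1 ->
  s ^+ 4 * (a / 6 * res ^+ 2 + r1 * beta / 5 * u ^+ 2) <=
    2 * (3 * B + s ^+ 4 * (E * beta ^+ 2)) ->
  3 * B + E * c2 ^+ 2 <= T ->
  res + u <= (2 + 12 * T / a + 10 * T / (r1 * c1)) / s.
Proof.
move=> a0 r10 c10 E0 B0 s1 res0 u0 b0 bl bu h TE.
have s0 : 0 < s by exact: lt_le_trans s1.
have s20 : 0 < s ^+ 2 by rewrite exprn_gt0.
have T0 : 0 <= T by apply: le_trans TE; rewrite addr_ge0// mulr_ge0// sqr_ge0.
have bl' : c1 <= beta * s ^+ 2 by rewrite -ler_pdivrMr.
have bu' : beta * s ^+ 2 <= c2 by rewrite -ler_pdivlMr.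
(* Since s^4 = K, the accumulated error is E (beta s^2)^2, and beta s^2 <= c2. *)
have hT : 3 * B + s ^+ 4 * (E * beta ^+ 2) <= T.
  apply: le_trans TE; rewrite lerD2l.
  have -> : s ^+ 4 * (E * beta ^+ 2) = E * (beta * s ^+ 2) ^+ 2 by ring.
  have bs0 : 0 <= beta * s ^+ 2 by rewrite mulr_ge0 ?ltW.
  by rewrite ler_wpM2l// ler_sqr ?nnegrE// (le_trans bs0).
have tot : s ^+ 4 * (a / 6 * res ^+ 2 + r1 * beta / 5 * u ^+ 2) <= 2 * T by lra.
have p1 : 0 <= s ^+ 4 * (a / 6 * res ^+ 2).
  by rewrite !mulr_ge0 ?exprn_ge0 ?invr_ge0// ltW.
have p2 : 0 <= s ^+ 4 * (r1 * beta / 5 * u ^+ 2).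
  by rewrite !mulr_ge0 ?exprn_ge0 ?invr_ge0// ltW.
(* The residual would even decay like s^-2; only s^-1 is kept, the rate available for u. *)
have ss : s ^+ 2 <= s ^+ 4.
  have -> : s ^+ 4 = s ^+ 2 * s ^+ 2 by ring.
  by rewrite ler_peMl ?(ltW s20)// exprn_ege1.
have q1 : (s * res) ^+ 2 <= 12 * T / a.
  rewrite ler_pdivlMr//.
  have : s ^+ 2 * (a * res ^+ 2) <= s ^+ 4 * (a * res ^+ 2).
    by rewrite ler_wpM2r// mulr_ge0 ?sqr_ge0// ltW.
  by lra.
have q2 : (s * u) ^+ 2 <= 10 * T / (r1 * c1).
  rewrite ler_pdivlMr ?mulr_gt0//.
  have : r1 * (s ^+ 2 * u ^+ 2) * c1 <= r1 * (s ^+ 2 * u ^+ 2) * (beta * s ^+ 2).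
    by rewrite ler_wpM2l// !mulr_ge0 ?sqr_ge0// ltW.
  by lra.
have f1 := le_of_sq_le_add1 _ _ (mulr_ge0 (ltW s0) res0) q1.
have f2 := le_of_sq_le_add1 _ _ (mulr_ge0 (ltW s0) u0) q2.
by rewrite ler_pdivlMr//; lra.
Qed.

Theorem theorem4p2 (R : realType) (nS nA : nat) (gamma : R) (rho : 'rV[R]_nS)
    (D L lambda r1 r2 tau sigma mu c1 c2 : R)
    (hgamma : 0 < gamma < 1) (hrho : simplex rho)
    (hL : 0 < L) (hlambda : 0 < lambda)
    (hr1 : 2 * L <= r1) (hr1' : l_pi nA gamma < r1)
    (hr2 : 2 * lambda * L <= r2)
    (htau : tau_cond L lambda r1 tau)
    (hsigma : sigma_cond L lambda r1 r2 tau sigma)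
    (hmu : mu_cond L lambda r2 sigma mu) (hmu1 : mu < 1)
    (hc : 0 < c1 <= c2) :
  exists2 C : R, 0 < C &
    forall (c : 'I_nS -> 'I_nA -> 'I_nS -> R) (P : set 'M[R]_(nS * nA, nS))
      (beta : nat -> R),
      (forall s a s', 0 <= c s a s' <= 1) ->
      ambiguity_set P ->
      bounded_mismatch gamma rho c P D ->
      grad_lipschitz gamma rho c P L (lambda * L) ->
      (forall K : nat, (2 <= K)%N ->
         [/\ beta_cond L lambda r1 sigma (beta K), beta K < 1
           & c1 * K%:R `^ (- 2^-1) <= beta K <= c2 * K%:R `^ (- 2^-1)]) ->
      forall K : nat, (2 <= K)%N ->
      forall (pi : nat -> 'M[R]_(nS, nA)) (p : nat -> 'M[R]_(nS * nA, nS))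
        (pib : nat -> 'M[R]_(nS, nA)) (pb : nat -> 'M[R]_(nS * nA, nS)),
        srpg_run gamma rho c P r1 r2 tau sigma (beta K) mu K pi p pib pb ->
        exists2 k : nat, (0 < k < K)%N &
          phi gamma rho c P (pib k.+1)
            - inf [set phi gamma rho c P w | w in @policies R nS nA]
          <= C * (Num.sqrt (diam (@policies R nS nA)) + Num.sqrt (diam P))
               / K%:R `^ (4^-1).
Proof.
pose l := lambda * L; pose kappa := kappa6 L r1 tau.
have l0 : 0 < l by rewrite mulr_gt0.
have hm : L <= r1 - L by lra.
have m0 : 0 < r1 - L by lra.
have r10 : 0 < r1 by lra.
have hr2l : 2 * l <= r2 by rewrite mulrA.
have r20 : 0 < r2 by lra.
have /andP[tau0] := htau; rewrite le_min => /andP[tau1 tau2].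
have /andP[sigma0] := hsigma; rewrite !le_min => /and3P[sigma1 sigma2 _].
have /andP[mu0 _] := hmu.
have tauL : 3 * (L + r1) <= 4 * tau^-1.
  move: tau1; rewrite ler_pdivlMr; last by lra.
  by rewrite mulrC -ler_pdivlMr.
have taul : 6 * l <= tau^-1.
  move: tau2; rewrite -mulrA -/l ler_pdivlMr; last by lra.
  by rewrite mulrC -ler_pdivlMr// div1r.
have kappaE : (r1 - L) * kappa = 2 * r1 + tau^-1.
  by rewrite /kappa /kappa6; field; rewrite !gt_eqF.
have ti0 : 0 < tau^-1 by rewrite invr_gt0.
have kappa0 : 0 < kappa by rewrite -(pmulr_rgt0 _ m0) kappaE; lra.
have sigmak : 3 * l * kappa ^+ 2 <= 2 * sigma^-1.
  move: sigma1; rewrite -/kappa -(mulrA 3) -/l ler_pdivlMr; last first.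
    by rewrite mulr_gt0 ?exprn_gt0// mulr_gt0.
  by rewrite mulrC -ler_pdivlMr.
(* Since kappa1 >= 1, the constant [Lphipi] is at least 2 l + r2. *)
have sigmal : 12 * l + 6 * r2 <= sigma^-1.
  have k1 : 1 <= kappa1 L l r1 by rewrite /kappa1 ler_pdivlMr//; lra.
  have hl : l * 1 <= l * kappa1 L l r1 by rewrite ler_wpM2l// ltW.
  have hphi : 2 * l + r2 <= Lphipi L l r1 r2 by rewrite /Lphipi; lra.
  have : 6 * Lphipi L l r1 r2 <= sigma^-1; last by lra.
  move: sigma2; rewrite -/l ler_pdivlMr; last by lra.
  by rewrite mulrC -ler_pdivlMr// div1r.
have si0 : 0 < sigma^-1 by rewrite invr_gt0.
have mu01 : 0 < mu < 1 by rewrite mu0.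
have [c10 c12] := andP hc.
have g1 : 0 < 1 - gamma by lra.
(* The smallest weight of a squared residual in [lyapunov_descent]. *)
pose a := Num.min (tau^-1 / 12) (Num.min (2 / 9 * sigma^-1) (r2 * mu / 2)).
have a0 : 0 < a by rewrite !lt_min !divr_gt0 ?mulr_gt0.
have a1 : a <= tau^-1 / 12 by rewrite ge_min lexx.
have a2 : a <= 2 / 9 * sigma^-1 by rewrite !ge_min lexx orbT.
have a3 : a <= r2 * mu / 2 by rewrite !ge_min lexx !orbT.
(* These constants precede any instance, so D >= 0 cannot yet be read off [bounded_mismatch]; [|D|]
   stands in for it. *)
pose B := (1 - gamma)^-1; pose M := `|D| / (1 - gamma).
pose dX : R := nS%:R * nA%:R; pose dY : R := (nS * nA)%:R * nS%:R.
pose lip := nA%:R / (1 - gamma) ^+ 2.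
pose E := 6 * r1 ^+ 2 * prox_const L l r1 r2 sigma kappa M dY ^+ 2 / a.
pose G := gap_const L l r1 r2 tau sigma M M dX dY lip.
pose T := 3 * B + E * c2 ^+ 2.
pose Q := 2 + 12 * T / a + 10 * T / (r1 * c1).
have B0 : 0 <= B by rewrite invr_ge0 ltW.
have M0 : 0 <= M by rewrite divr_ge0// ltW.
have E0 : 0 <= E by rewrite divr_ge0 ?(ltW a0)// mulr_ge0 ?sqr_ge0// mulr_ge0 ?sqr_ge0.
have T0 : 0 <= T by rewrite addr_ge0// mulr_ge0// sqr_ge0.
have Q0 : 0 <= Q.
  by rewrite !addr_ge0// divr_ge0 ?mulr_ge0 ?(ltW a0) ?(ltW r10) ?(ltW c10).
have G0 : 0 <= G.
  have dX0 : 0 <= dX by rewrite mulr_ge0.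
  have dY0 : 0 <= dY by rewrite mulr_ge0.
  have lip0 : 0 <= lip by rewrite divr_ge0// exprn_ge0// ltW.
  rewrite /G /gap_const !addr_ge0// !mulr_ge0// !addr_ge0// ltW//.
exists (G * Q + 1); first by rewrite ltr_wpDl// mulr_ge0.
move=> c P beta hcost hP hD glip hbeta K K2 pi p pib pb run.
have [bcond _ /andP[bl bu]] := hbeta K K2.
(* Dropping the other nonnegative terms of the denominator leaves 24 r1 / (360 r1) = 1 / 15. *)
have beta01 : 0 < beta K <= 1 / 15.
  have /andP[-> ] := bcond; rewrite le_min => /andP[b1 _]; apply: le_trans b1 _.
  rewrite ler_pdivrMr.
    have := sqr_ge0 (2 * lambda * L + 5 * r1).
    by have := mulr_ge0 (sqr_ge0 r1) (ltW hlambda); lra.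
  have := sqr_ge0 (2 * lambda * L + 5 * r1).
  by have := mulr_ge0 (sqr_ge0 r1) (ltW hlambda); lra.
have hDabs : bounded_mismatch gamma rho c P `|D|.
  have le_abs : (D%:E <= `|D|%:E)%E by rewrite lee_fin ler_norm.
  have [hD1 hD2] := hD; split.
    move=> w hw; have [q [Pq hq mm]] := hD1 w hw.
    by exists q; split => //; exact: le_trans mm le_abs.
  move=> q hq; have [w [hw hmin mm]] := hD2 q hq.
  by exists w; split => //; exact: le_trans mm le_abs.
have [k kK [res [u [res0 u0 Xz hgap hsum]]]] := srpg_gap gamma rho c P `|D|
  hgamma hrho hcost hP hDabs (normr_ge0 D) L l r1 r2 tau sigma kappa mu (beta K) a
  K pi p pib pb hL l0 hr1 r20 tau0 sigma0 tauL taul kappaE sigmak sigmal mu01 beta01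
  a0 a1 a2 a3 glip run K2.
exists k => //.
set s := K%:R `^ 4^-1.
have K1 : 1 <= K%:R :> R by rewrite ler1n ltnW.
have s4 : s ^+ 4 = K%:R := fourth_root_pow4 K.
have s1 : 1 <= s.
  rewrite -(@ler_pXn2r _ 4)// ?nnegrE ?powR_ge0//.
  by rewrite expr1n s4.
have s0 : 0 < s by exact: lt_le_trans s1.
rewrite fourth_root_invsqrt -/s in bl bu; rewrite -s4 in hsum.
have [b0 _] := andP beta01.
have rate : res + u <= Q / s.
  exact: (rate_of_average _ _ _ _ _ _ _ _ _ _ _ a0 r10 c10 E0 B0 s1 res0 u0 b0 bl bu hsum).
set dd := Num.sqrt _ + Num.sqrt _.
have dd0 : 0 <= dd by rewrite addr_ge0 ?sqrtr_ge0.
have key w : policies w ->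
    phi gamma rho c P (pib k.+1) - phi gamma rho c P w <= (G * Q + 1) * dd / s.
  (* With at most one action the diameters may vanish, but there is only one policy and the gap is
     zero. *)
  move=> hw; have [nA1|nA2] := leqP nA 1.
    rewrite (policies_subsingleton w (pib k.+1))// subrr.
    by rewrite divr_ge0 ?(ltW s0)// mulr_ge0// addr_ge0// mulr_ge0.
  have dd1 : 1 <= dd.
    have nS0 : (0 < nS)%N.
      rewrite lt0n; apply/eqP => n0; have [_] := hrho.
      rewrite big1 => [/eqP|i _]; first by rewrite eq_sym oner_eq0.
      by have := ltn_ord i; rewrite [X in (_ < X)%N]n0.
    have h := diam_policies_ge1 (R := R) (Ordinal nS0) nA2.
    rewrite -[1]addr0 lerD ?sqrtr_ge0//.
    by rewrite -[1]sqrtr1 ler_sqrt// (le_trans ler01).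
  apply: le_trans (hgap w hw) _; rewrite -/G.
  apply: le_trans (ler_wpM2l G0 rate) _.
  rewrite mulrA ler_wpM2r ?invr_ge0 ?(ltW s0)//.
  apply: le_trans (_ : (G * Q + 1) * 1 <= _); first by rewrite mulr1 lerDl.
  by rewrite ler_wpM2l// addr_ge0// mulr_ge0.
rewrite lerBlDr -lerBlDl; apply: lb_le_inf.
  by exists (phi gamma rho c P (pib k.+1)); exists (pib k.+1).
by move=> _ [w hw <-]; rewrite lerBlDl -lerBlDr; exact: key.
Qed.
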